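(* Let $I,J$ be finite nonempty index sets, let $P_i(x)$ ($i\in I$) and $Q_j(x)$ ($j\in J$) be initial probability distributions with full support on some finite set $\mathcal X$, and let $P_i(x_2|x_1)$ and $Q_j(x_2|x_1)$ be matrices of strictly positive transition probabilities on $\mathcal X$, so that the joint distributions of the samples are \[P_{i,n}(x_0,x_1,\dots,x_n)=P_i(x_0)P_i(x_1|x_0)P_i(x_2|x_1)\cdots P_i(x_n|x_{n-1}),\] \[Q_{j,n}(x_0,x_1,\dots,x_n)=Q_j(x_0)Q_j(x_1|x_0)Q_j(x_2|x_1)\cdots Q_j(x_n|x_{n-1}).\] Consider the composite hypothesis testing problem with samples drawn from the sets of Markov processes $P=(P_{i,n})_{i\in I}$ and $Q=(Q_{j,n})_{j\in J}$. Imposing a bound of $2^{-nr+o(n)}$ on the type II error probability, the optimal strong converse exponent $R^*(r)$ for the type I error is \[R^*(r)=\sup_{\alpha>1}\max_{\substack{i\in I\\ \gamma\in\mathcal P(J)}}\frac{\alpha-1}{\alpha}\left[r-\frac1{\alpha-1}\log_2\rho\left(\Big(P_i(x|x')^\alpha\prod_{j\in J}Q_j(x|x')^{(1-\alpha)\gamma(j)}\Big)_{x,x'\in\mathcal X}\right)\right],\] where $\rho$ denotes the spectral radius.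
   Context: $\mathcal P(J)$ is the set of probability distributions on the finite set $J$. Transition probabilities satisfy $\sum_{x_2}P_i(x_2|x_1)=1$ for every $x_1\in\mathcal X$, and similarly for $Q_j$. Hypothesis testing: the null hypothesis is that the sample $(x_0,\dots,x_n)\in\mathcal X^{n+1}$ is distributed according to one of the $P_{i,n}$ ($i\in I$), the alternative that it is distributed according to one of the $Q_{j,n}$ ($j\in J$). A (randomized) test is a function $T_n:\mathcal X^{n+1}\to[0,1]$ giving the probability of accepting the null hypothesis. Its worst-case type I and type II error probabilities are $\alpha_n(T_n)=\max_{i\in I}\big(1-\sum_xT_n(x)P_{i,n}(x)\big)$ and $\beta_n(T_n)=\max_{j\in J}\sum_xT_n(x)Q_{j,n}(x)$. For $r\ge0$, the optimal strong converse exponent $R^*(r)$ is the smallest $R$ such that there is a sequence of tests with $\beta_n(T_n)\le2^{-nr+o(n)}$ and $1-\alpha_n(T_n)\ge2^{-nR+o(n)}$. *)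

(* Defs.v *)
From HB Require Import structures.
From mathcomp Require Import all_boot all_order all_algebra.
From mathcomp Require Import complex.
From mathcomp Require Import all_classical all_reals all_analysis.

Set Implicit Arguments.
Unset Strict Implicit.
Unset Printing Implicit Defensive.

Import Order.TTheory GRing.Theory Num.Theory.
Import numFieldNormedType.Exports.

Local Open Scope classical_set_scope.
Local Open Scope ring_scope.

Definition log2 (R : realType) (x : R) : R := ln x / ln 2.

Definition is_max (R : realType) (A : set R) (m : R) : Prop :=
  A m /\ ubound A m.

Definition is_min (R : realType) (A : set R) (m : R) : Prop :=
  A m /\ lbound A m.

Definition is_distr (R : realType) (T : finType) (p : T -> R) : Prop :=
  (forall x, 0 <= p x) /\ \sum_x p x = 1.

(* The eigenvalues of a real matrix are taken in the complex field R[i].  For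
   n > 0 their set is finite and nonempty, so that [sup] is a maximum. *)
Definition spectral_radius (R : realType) (n : nat) (A : 'M[R]_n) : R :=
  sup [set ComplexField.Normc.normc z
      | z in [set z : R[i] | eigenvalue (map_mx (real_complex R) A) z]].

Definition mx_of_fun (R : realType) (X : finType) (F : X -> X -> R) :
    'M[R]_#|X| :=
  \matrix_(k, l) F (enum_val k) (enum_val l).

(* [W x2 x1] is the transition probability W(x2|x1): the state x1 that is left
   is the second argument. *)
Definition markov_prob (R : realType) (X : finType)
    (p : X -> R) (W : X -> X -> R) (n : nat) (x : {ffun 'I_n.+1 -> X}) : R :=
  p (x ord0) *
  \prod_(k < n) W (x (lift ord0 k)) (x (widen_ord (leqnSn n) k)).

Definition is_test (R : realType) (X : finType) (n : nat)
    (T : {ffun 'I_n.+1 -> X} -> R) : Prop :=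
  forall x, 0 <= T x <= 1.

Definition accept_prob (R : realType) (X : finType)
    (p : X -> R) (W : X -> X -> R) (n : nat)
    (T : {ffun 'I_n.+1 -> X} -> R) : R :=
  \sum_x T x * markov_prob p W x.

(* In both errors the default value 0 of the maximum plays no role: the index
   set is nonempty and the error probabilities are nonnegative. *)
Definition type1_error (R : realType) (X I : finType)
    (P0 : I -> X -> R) (P : I -> X -> X -> R) (n : nat)
    (T : {ffun 'I_n.+1 -> X} -> R) : R :=
  \big[Num.max/0]_(i : I) (1 - accept_prob (P0 i) (P i) T).

Definition type2_error (R : realType) (X J : finType)
    (Q0 : J -> X -> R) (Q : J -> X -> X -> R) (n : nat)
    (T : {ffun 'I_n.+1 -> X} -> R) : R :=
  \big[Num.max/0]_(j : J) accept_prob (Q0 j) (Q j) T.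

Definition sublinear (R : realType) (e : nat -> R) : Prop :=
  (e : nat -> R^o) =o_\oo ((fun n => n%:R) : nat -> R^o).

Definition sc_achievable (R : realType) (X I J : finType)
    (P0 : I -> X -> R) (P : I -> X -> X -> R)
    (Q0 : J -> X -> R) (Q : J -> X -> X -> R) (r s : R) : Prop :=
  exists T : forall n, {ffun 'I_n.+1 -> X} -> R,
    [/\ forall n, is_test (T n),
        exists2 e : nat -> R, sublinear e &
          forall n, type2_error Q0 Q (T n) <= 2 `^ (- n%:R * r + e n)
      & exists2 e : nat -> R, sublinear e &
          forall n, 2 `^ (- n%:R * s + e n) <= 1 - type1_error P0 P (T n)].

Definition is_opt_sc_exponent (R : realType) (X I J : finType)
    (P0 : I -> X -> R) (P : I -> X -> X -> R)
    (Q0 : J -> X -> R) (Q : J -> X -> X -> R) (r Rstar : R) : Prop :=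
  is_min [set s | sc_achievable P0 P Q0 Q r s] Rstar.

Definition exponent_bound (R : realType) (X J : finType)
    (W : X -> X -> R) (Q : J -> X -> X -> R) (r a : R) (g : J -> R) : R :=
  (a - 1) / a *
  (r - 1 / (a - 1) *
       log2 (spectral_radius (mx_of_fun (fun x x' =>
         W x x' `^ a * \prod_(j : J) Q j x x' `^ ((1 - a) * g j))))).

(* Main.v *)
(* Idea. For [nu >= 0] tilt the null chain to the positive matrix
   [P * prod_j (P / Q_j) ^ nu_j]; with [nu = (alpha - 1) gamma] its spectral
   radius is the one in the theorem. Lower bound on the exponent: comparing the
   likelihood ratio of [P_n] and of the geometric mean of the [Q_{j,n}] with a
   threshold [t] bounds the acceptance probability by
   [e ^ t beta_n + e ^ (- (alpha - 1) t) Z_n], where [Z_n] is a sum over paths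
   of the tilted weights, hence [O (rho ^ n)].
   Upper bound: if [c] dominates all the bounds, then
   [H nu = |nu| (r - c) - c - ln (rho nu)] is nonpositive. Maximize it over
   [{nu >= 0, |nu| <= N}] and let [W] be the Markov chain obtained from the
   tilted matrix at the maximizer by normalizing with its Perron eigenvector.
   The first-order optimality conditions say that the relative entropy rates
   of [W] satisfy [D(W|P) <= c] and [r - D(W|Q_j) + D(W|P) <= c + c / N], so
   that accepting, with a suitable constant probability, the paths which are
   typical for [W] is a good test. Averaging over [i] treats the composite null
   hypothesis; a near-optimal test for each [n] removes the error [c / N].
   Entropy rates are defined through the Poisson equation, which makes the
   additive functionals of [W] martingales up to bounded terms and yields the
   law of large numbers from Chebyshev's inequality. *)

Require Import Defs.
From HB Require Import structures.
From mathcomp Require Import all_boot all_order all_algebra.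
From mathcomp Require Import complex ring lra.
From mathcomp Require Import all_classical all_reals all_analysis.
Import Order.TTheory GRing.Theory Num.Theory.
Import numFieldNormedType.Exports.
Local Open Scope classical_set_scope.
Local Open Scope ring_scope.

(** * Minima over compact sets of functions, and elementary finite sums *)

(** Functions on [T] are transported to row vectors, where closed bounded sets are compact and the
    extreme value theorem applies. Closedness is phrased as stability under uniform approximation,
    so that applications need no topology. *)
Lemma lipschitz_argmin (R : realType) (T : finType) (F : (T -> R) -> R)
    (L B : R) (C : set (T -> R)) :
  C !=set0 ->
  (forall u, C u -> forall t, `|u t| <= B) ->
  (forall u, (forall e, 0 < e ->
     exists2 u', C u' & forall t, `|u t - u' t| <= e) -> C u) ->
  (forall u u' e, 0 <= e -> (forall t, `|u t - u' t| <= e) ->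
     F u <= F u' + L * e) ->
  exists2 u, C u & forall u', C u' -> F u <= F u'.
Proof.
move=> [u0 Cu0] bC clC lipF.
pose fn (v : 'rV[R]_#|T|) : T -> R := fun t => v ord0 (enum_rank t).
pose A : set 'rV[R]_#|T| := [set v | C (fn v)].
have fnE u : fn (\row_k u (enum_val k)) = u.
  by apply/funext => t; rewrite /fn mxE enum_rankK.
have A0 : A !=set0 by exists (\row_k u0 (enum_val k)); rewrite /A /= fnE.
have ballE (v w : 'rV[R]_#|T|) e : ball v e w -> forall t, `|fn v t - fn w t| <= e.
  by move=> [e0 H] t; have := H ord0 (enum_rank t); rewrite /ball /= => /ltW.
have clA : closed A.
  move=> v clv; apply: clC => e e0.
  have [w [Aw vw]] := clv _ (nbhsx_ballx v e e0).
  by exists (fn w) => //; exact: ballE.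
have cA : compact A.
  have Mnco : compact [set v : 'rV[R]_#|T| | forall i, v ord0 i \in `[- B, B]].
    apply: (@rV_compact _ _ (fun=> `[- B, B]%classic)).
    by move=> _; exact: segment_compact.
  apply: subclosed_compact clA Mnco _ => v Av i.
  by have := bC _ Av (enum_val i); rewrite /fn enum_valK in_itv /= ler_norml.
have cF : continuous (F \o fn).
  move=> v; apply/(@cvgrPdist_lt _ _ _ _ (nbhs_filter v)) => e e0.
  pose d := e / (2 * (1 + `|L|)).
  have d0 : 0 < d by rewrite divr_gt0// mulr_gt0// ltr_pwDl.
  have Ld : L * d < e.
    rewrite /d mulrA ltr_pdivrMr ?mulr_gt0 ?ltr_pwDl// mulrC ltr_pM2l//.
    by have := ler_norm L; have := normr_ge0 L; lra.
  apply: filterS (nbhsx_ballx v d d0) => w bvw.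
  have h1 := lipF (fn v) (fn w) d (ltW d0) (ballE _ _ _ bvw).
  have h2 := lipF (fn w) (fn v) d (ltW d0) (ballE _ _ _ (ball_sym bvw)).
  by rewrite /= ltr_norml; apply/andP; split; lra.
have [c cA' cmin] :=
  EVT_min_rV A0 cA (continuous_subspaceT cF).
exists (fn c); first by move: cA'; rewrite inE.
move=> u' Cu'; have := cmin (\row_k u' (enum_val k)).
by rewrite /= fnE; apply; rewrite inE /A /= fnE.
Qed.

Lemma fin_bounded (R : realType) (T : finType) (f : T -> R) :
  exists2 B, 0 <= B & forall t, `|f t| <= B.
Proof.
exists (\sum_t `|f t|); first exact: sumr_ge0.
by move=> t; rewrite (bigD1 t)//= lerDl sumr_ge0.
Qed.

Lemma ltr_sum_pos (R : realType) (T : finType) (f g : T -> R) (t0 : T) :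
  (forall t, f t <= g t) -> f t0 < g t0 -> \sum_t f t < \sum_t g t.
Proof.
move=> fg fg0; rewrite (bigD1 t0)//= [ltRHS](bigD1 t0)//=.
by rewrite ltr_leD// ler_sum.
Qed.

Lemma sumr_fin_gt0 (R : realType) (T : finType) (f : T -> R) (t0 : T) :
  (forall t, 0 < f t) -> 0 < \sum_t f t.
Proof.
move=> f0; rewrite (bigD1 t0)//= ltr_pwDl// sumr_ge0// => t _; exact: ltW.
Qed.

Lemma fin_argmin (R : realType) (T : finType) (f : T -> R) (t0 : T) :
  exists t, forall t', f t <= f t'.
Proof. by case: (@arg_minP _ _ _ t0 predT f) => // t _ H; exists t => t';
  apply: H. Qed.

(** * Perron theory *)

(** With [v = expR u], minimize the largest ratio of [vA] to [v] (Collatz-Wielandt). If [vA <= l v]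
    were strict at some state for the minimizer, positivity of [A] would give [zA < l z] everywhere
    for [z = vA], contradicting minimality. *)
Lemma perron (R : realType) (X : finType) (x0 : X) (A : X -> X -> R) :
  (forall x y, 0 < A x y) ->
  exists v : X -> R, exists2 l, 0 < l &
    (forall x, 0 < v x) /\ (forall y, \sum_x v x * A x y = l * v y).
Proof.
move=> A0.
have [B B0 hB] := fin_bounded R (X * X)%type (fun p => ln (A p.1 p.2)).
have {}hB x y : `|ln (A x y)| <= B by exact: (hB (x, y)).
pose s (u : X -> R) y := \sum_x expR (u x - u y) * A x y.
have s0 u y : 0 < s u y.
  by apply: sumr_fin_gt0 => // x; rewrite mulr_gt0// expR_gt0.
pose F u := \big[Num.max/ln (s u x0)]_y ln (s u y).
have sF u y : s u y <= expR (F u).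
  by rewrite -[leLHS]lnK ?posrE// ler_expR; exact: le_bigmax.
(* For every positive [v] the entries of [vA] differ by a factor of at most [expR (2 * B)]. Hence
   the competitor [u'] below, normalized to have minimum 0, lies in this box. *)
pose C := [set u : X -> R | forall x, 0 <= u x <= 2 * B].
have [|u Cu|u Hu|u u' e e0 He|u Cu umin] := lipschitz_argmin R X F 2 (2 * B) C.
- by exists (fun=> 0) => x; rewrite lexx mulr_ge0.
- by move=> t; have /andP[h1 h2] := Cu t; rewrite ger0_norm.
- move=> x; apply/andP; split; apply/ler_addgt0Pr => e e0;
    have [u' Cu' /(_ x)] := Hu e e0; rewrite ler_norml;
    by have /andP[] := Cu' x; lra.
- have H y : ln (s u y) <= F u' + 2 * e.
    have : s u y <= expR (2 * e) * s u' y.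
      rewrite /s mulr_sumr; apply: ler_sum => x _.
      rewrite mulrA (ler_wpM2r (ltW (A0 x y)))// -expRD ler_expR.
      by have := He x; have := He y; rewrite !ler_norml; lra.
    move=> h; apply: (@le_trans _ _ (ln (expR (2 * e) * s u' y))).
      by rewrite ler_ln ?posrE ?mulr_gt0 ?expR_gt0.
    rewrite lnM ?posrE ?expR_gt0// expRK addrC lerD2r.
    exact: le_bigmax.
  exact: bigmax_le.
exists (fun x => expR (u x)); exists (expR (F u)); first exact: expR_gt0.
split=> [x|]; first exact: expR_gt0.
pose v x := expR (u x); pose l := expR (F u).
have v0 x : 0 < v x by exact: expR_gt0.
have sE w y : s w y = (\sum_x expR (w x) * A x y) / expR (w y).
  rewrite /s mulr_suml; apply: eq_bigr => x _.
  by rewrite expRD expRN mulrAC.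
have vA y : \sum_x v x * A x y <= l * v y.
  by rewrite -ler_pdivrMr//; have := sF u y; rewrite sE.
apply: contrapT => /existsNP[y0 ny0].
have y0lt : \sum_x v x * A x y0 < l * v y0.
  by rewrite lt_neqAle vA andbT; apply/eqP.
pose z y := \sum_x v x * A x y.
have z0 y : 0 < z y by apply: sumr_fin_gt0 => // x; rewrite mulr_gt0.
have zA y : \sum_x z x * A x y < l * z y.
  rewrite /z mulr_sumr.
  apply: (ltr_sum_pos _ _ _ _ y0) => [x|]; rewrite mulrA.
    by rewrite ler_pM2r.
  by rewrite ltr_pM2r.
have [m zm] := fin_argmin R X z x0.
pose u' x := ln (z x) - ln (z m).
have eu' x : expR (u' x) = z x / z m.
  by rewrite expRD expRN !lnK ?posrE.
have Cu' : C u'.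
  move=> x; rewrite /u' subr_ge0 ler_ln ?posrE// zm/= lerBlDr -[leRHS]expRK.
  rewrite ler_ln ?posrE ?expR_gt0// expRD lnK ?posrE// /z mulr_sumr.
  apply: ler_sum => t _; rewrite mulrCA (ler_wpM2l (ltW (v0 t)))//.
  rewrite -(lnK (A0 t x)) -(lnK (A0 t m)) -expRD ler_expR.
  by have := hB t x; have := hB t m; rewrite !ler_norml; lra.
have := umin _ Cu'; apply/negP; rewrite -ltNge.
have H y : ln (s u' y) < F u.
  rewrite -[ltRHS]expRK ltr_ln ?posrE ?expR_gt0// sE eu'.
  rewrite ltr_pdivrMr ?divr_gt0// mulrA ltr_pdivlMr// mulr_suml.
  have -> : \sum_i expR (u' i) * A i y * z m = \sum_x z x * A x y.
    apply: eq_bigr => x _; rewrite eu' mulrAC divfK//.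
    by rewrite gt_eqF.
  exact: zA.
exact: bigmax_lt.
Qed.

(** At a state [y] where [v / w] attains its maximum [m], the value [t * v y] is at most the entry
    of [vA], hence at most [m] times that of [wA], hence at most [m * l * w y = l * v y]. *)
Lemma sub_super_eigenvalue_le (R : realType) (X : finType) (A : X -> X -> R)
    (w v : X -> R) (l t : R) (x0 : X) :
  (forall x y, 0 <= A x y) -> (forall x, 0 < w x) ->
  (forall y, \sum_x w x * A x y <= l * w y) ->
  (forall x, 0 <= v x) -> 0 < v x0 ->
  (forall y, t * v y <= \sum_x v x * A x y) -> t <= l.
Proof.
move=> A0 w0 wA v0 vx0 vA.
have [y ymax] := fin_argmin R X (fun x => - (v x / w x)) x0.
pose m := v y / w y.
have vm x : v x <= m * w x.
  by rewrite -ler_pdivrMr//; have := ymax x; rewrite lerN2.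
have m0 : 0 < m.
  by apply: lt_le_trans (_ : v x0 / w x0 <= _);
    rewrite ?divr_gt0 ?ler_pdivrMr.
have vy : v y = m * w y by rewrite /m divfK// gt_eqF.
have vy0 : 0 < v y by rewrite vy mulr_gt0.
rewrite -(ler_pM2r vy0) (le_trans (vA y))//.
apply: (@le_trans _ _ (m * \sum_x w x * A x y)).
  rewrite mulr_sumr; apply: ler_sum => x _.
  by rewrite mulrA ler_wpM2r.
by rewrite vy mulrCA ler_pM2l.
Qed.

Lemma normc_sum_le (R : rcfType) (T : finType) (f : T -> R[i]) :
  ComplexField.Normc.normc (\sum_t f t) <=
  \sum_t ComplexField.Normc.normc (f t).
Proof.
apply: (big_ind2 (fun a b => ComplexField.Normc.normc a <= b)) => //.
  by rewrite ComplexField.Normc.normc0.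
move=> a b c d ab cd.
have := @le_normcD R a c; move/le_trans; apply; exact: lerD.
Qed.

(** For a complex left eigenvector [u] with eigenvalue [z], the triangle inequality gives
    [|z| |u| <= |u| A] entrywise, so comparison with [v] yields [|z| <= l]; and [v] shows that [l]
    is itself an eigenvalue. *)
Lemma spectral_radiusE (R : realType) (X : finType) (x0 : X)
    (A : X -> X -> R) (v : X -> R) (l : R) :
  (forall x y, 0 <= A x y) -> (forall x, 0 < v x) -> 0 < l ->
  (forall y, \sum_x v x * A x y = l * v y) ->
  spectral_radius (mx_of_fun A) = l.
Proof.
move=> A0 v0 l0 vA; rewrite /spectral_radius; set S := image _ _.
have sumE (K : nmodType) (f : X -> K) : \sum_(k < #|X|) f (enum_val k) = \sum_x f x.
  by rewrite -(big_enum_val f).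
have normr : ComplexField.Normc.normc (real_complex R l) = l.
  by rewrite /ComplexField.Normc.normc /= expr0n/= addr0 sqrtr_sqr gtr0_norm.
have Sl : S l.
  exists (real_complex R l) => //=; apply/eigenvalueP.
  exists (\row_k real_complex R (v (enum_val k))).
    apply/rowP => k; rewrite !mxE.
    rewrite (eq_bigr (fun i => real_complex R
      (v (enum_val i) * A (enum_val i) (enum_val k)))); last first.
      by move=> i _; rewrite !mxE rmorphM.
    by rewrite -rmorph_sum -rmorphM -vA (sumE _ (fun x => v x * A x _)).
  apply/eqP => /rowP /(_ (enum_rank x0)); rewrite !mxE enum_rankK.
  by case=> /eqP; rewrite gt_eqF.
have ubS : ubound S l.
  move=> _ [z /= /eigenvalueP[u uA u0] <-].
  have [k uk] : exists k, u ord0 k != 0.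
    apply: contrapT => nk; case/eqP: u0; apply/rowP => k; rewrite mxE.
    by apply/eqP/negP => /negP ?; apply: nk; exists k.
  pose n x := ComplexField.Normc.normc (u ord0 (enum_rank x)).
  apply: (@sub_super_eigenvalue_le R X A v n l _ (enum_val k)) => //.
  - by move=> y; rewrite vA.
  - by move=> x; rewrite /n /ComplexField.Normc.normc; case: (u _ _) => a b;
    exact: sqrtr_ge0.
  - rewrite /n enum_valK lt_neqAle; apply/andP; split.
      by rewrite eq_sym; apply: contra uk => /eqP/ComplexField.Normc.eq0_normc ->.
    by rewrite /ComplexField.Normc.normc; case: (u _ _) => a b; exact: sqrtr_ge0.
  - move=> y; have /rowP/(_ (enum_rank y)) := uA; rewrite !mxE => H.
    rewrite /n -ComplexField.Normc.normcM -H.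
    apply: le_trans (normc_sum_le _ _ _) _.
    rewrite -(sumE _ (fun x => ComplexField.Normc.normc (u ord0 (enum_rank x))
      * A x y)).
    apply: ler_sum => i _; rewrite !mxE enum_rankK ComplexField.Normc.normcM
      enum_valK.
    by rewrite [X in _ * X <= _]/ComplexField.Normc.normc /= expr0n/= addr0
      sqrtr_sqr ger0_norm.
apply/eqP; rewrite eq_le; apply/andP; split.
  by apply: ge_sup => //; exists l.
apply: sup_upper_bound => //; split; first by exists l.
by exists l.
Qed.

Lemma perron_spectral_radius (R : realType) (X : finType) (x0 : X)
    (A : X -> X -> R) :
  (forall x y, 0 < A x y) ->
  0 < spectral_radius (mx_of_fun A) /\
  exists2 v : X -> R, (forall x, 0 < v x) &
    forall y, \sum_x v x * A x y = spectral_radius (mx_of_fun A) * v y.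
Proof.
move=> A0; have [v [l l0 [v0 vA]]] := perron R X x0 A A0.
rewrite (spectral_radiusE R X x0 A v l) //; first by split => //; exists v.
by move=> *; exact: ltW.
Qed.

Lemma spectral_radius_le (R : realType) (X : finType) (x0 : X)
    (A : X -> X -> R) (w : X -> R) (l : R) :
  (forall x y, 0 < A x y) -> (forall x, 0 < w x) ->
  (forall y, \sum_x w x * A x y <= l * w y) ->
  spectral_radius (mx_of_fun A) <= l.
Proof.
move=> A0 w0 wA; have [_ [v v0 vA]] := perron_spectral_radius R X x0 A A0.
apply: (@sub_super_eigenvalue_le R X A w v l _ x0) => //.
- by move=> *; exact: ltW.
- by move=> *; exact: ltW.
- by move=> y; rewrite vA.
Qed.

Lemma spectral_radius_scale_le (R : realType) (X : finType) (x0 : X)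
    (A B : X -> X -> R) (c : R) :
  (forall x y, 0 < A x y) -> (forall x y, 0 < B x y) ->
  (forall x y, A x y <= c * B x y) ->
  spectral_radius (mx_of_fun A) <= c * spectral_radius (mx_of_fun B).
Proof.
move=> A0 B0 AB; have [_ [v v0 vB]] := perron_spectral_radius R X x0 B B0.
apply: (spectral_radius_le R X x0 A v) => // y.
rewrite -mulrA -vB mulr_sumr; apply: ler_sum => x _.
by rewrite mulrCA ler_pM2l.
Qed.

Lemma spectral_radius_stoch (R : realType) (X : finType) (x0 : X)
    (W : X -> X -> R) :
  (forall x y, 0 < W x y) -> (forall y, \sum_x W x y = 1) ->
  spectral_radius (mx_of_fun W) = 1.
Proof.
move=> W0 W1; apply: (spectral_radiusE R X x0 W (fun=> 1)) => //.
  by move=> *; exact: ltW.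
by move=> y; under eq_bigr do rewrite mul1r; rewrite W1 mulr1.
Qed.

(** * Markov chains and additive functionals *)

(** The Poisson equation with corrector [h]. For a stochastic [W] the number [c] is the stationary
    mean of [f]; no stationary distribution has to be constructed. *)
Definition has_drift (R : realType) (X : finType) (W f : X -> X -> R) (c : R) :=
  exists h : X -> R, forall y, \sum_x W x y * (f x y + h x - h y) = c.
Arguments has_drift {R X} W f c.

(** Maximum principle: the sum is nonnegative at a minimum of [h] and nonpositive at a maximum, so
    [c = 0]. At the minimum all summands are then zero, and positivity of [W] makes [h] constant. *)
Lemma harmonic_const (R : realType) (X : finType) (x0 : X) (W : X -> X -> R)
    (h : X -> R) (c : R) :
  (forall x y, 0 < W x y) ->
  (forall y, \sum_x W x y * (h x - h y) = c) -> c = 0 /\ forall x, h x = h x0.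
Proof.
move=> W0 Wh.
have [m hm] := fin_argmin R X h x0.
have [M hM] := fin_argmin R X (fun x => - h x) x0.
have c0 : c = 0.
  apply/eqP; rewrite eq_le; apply/andP; split.
    rewrite -(Wh M); apply: sumr_le0 => x _.
    by rewrite pmulr_rle0// subr_le0 -lerN2.
  rewrite -(Wh m); apply: sumr_ge0 => x _.
  by rewrite pmulr_rge0// subr_ge0.
split=> //.
have hc x : h x = h m.
  have := Wh m; rewrite c0 => /eqP; rewrite psumr_eq0; last first.
    by move=> z _; rewrite pmulr_rge0// subr_ge0.
  move=> /allP /(_ x (mem_index_enum x)) /implyP /(_ isT).
  by rewrite mulf_eq0 gt_eqF//= subr_eq0 => /eqP.
by move=> x; rewrite !hc.
Qed.

Lemma drift_ext (R : realType) (X : finType) (W f g : X -> X -> R) (c : R) :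
  (forall x y, f x y = g x y) -> has_drift W f c -> has_drift W g c.
Proof.
by move=> fg [h H]; exists h => y; rewrite -(H y); apply: eq_bigr => x _;
  rewrite fg.
Qed.

(** The difference of two correctors has constant mean increment, and the maximum principle forces
    this constant to be 0. *)
Lemma drift_unique (R : realType) (X : finType) (x0 : X) (W f : X -> X -> R)
    (c c' : R) :
  (forall x y, 0 < W x y) ->
  has_drift W f c -> has_drift W f c' -> c = c'.
Proof.
move=> W0 [h H] [h' H'].
have [|] := harmonic_const R X x0 W (fun x => h x - h' x) (c - c') W0.
  move=> y; rewrite -(H y) -(H' y) -sumrB; apply: eq_bigr => x _; ring.
by move=> /eqP; rewrite subr_eq0 => /eqP.
Qed.

Lemma drift_lin (R : realType) (X : finType) (W f g : X -> X -> R)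
    (a c c' : R) :
  has_drift W f c -> has_drift W g c' ->
  has_drift W (fun x y => f x y + a * g x y) (c + a * c').
Proof.
move=> [h H] [h' H']; exists (fun x => h x + a * h' x) => y.
rewrite -(H y) -(H' y) mulr_sumr -big_split/=; apply: eq_bigr => x _; ring.
Qed.

Lemma drift_sum (R : realType) (X J : finType) (W : X -> X -> R)
    (f : J -> X -> X -> R) (a c : J -> R) :
  (forall j, has_drift W (f j) (c j)) ->
  has_drift W (fun x y => \sum_j a j * f j x y) (\sum_j a j * c j).
Proof.
move=> /choice[h H]; exists (fun x => \sum_j a j * h j x) => y.
under [RHS]eq_bigr do rewrite -(H _ y) mulr_sumr.
rewrite exchange_big/=; apply: eq_bigr => x _.
rewrite -big_split/= -sumrB mulr_sumr; apply: eq_bigr => j _; ring.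
Qed.

Lemma drift_coboundary (R : realType) (X : finType) (W : X -> X -> R)
    (u : X -> R) (c : R) :
  (forall y, \sum_x W x y = 1) ->
  has_drift W (fun x y => u x - u y + c) c.
Proof.
move=> W1; exists (fun x => - u x) => y.
transitivity (\sum_x W x y * c); first by apply: eq_bigr => x _; ring.
by rewrite -mulr_suml W1 mul1r.
Qed.

(** The Poisson equation is a square linear system once [h x0 = 0] is imposed and the freed
    coordinate carries the unknown [c]. Its kernel is trivial by the maximum principle. *)
Lemma drift_exists (R : realType) (X : finType) (x0 : X) (W f : X -> X -> R) :
  (forall x y, 0 < W x y) -> (forall y, \sum_x W x y = 1) ->
  exists c, has_drift W f c.
Proof.
move=> W0 W1.
pose k0 := enum_rank x0.
(* The row of ones at [k0] multiplies the unknown [c]; the other rows are those of the identity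
   minus the transition matrix. *)
pose N : 'M[R]_#|X| := \matrix_(k, l)
  (if k == k0 then 1 else (k == l)%:R - W (enum_val k) (enum_val l)).
pose h (u : 'rV[R]_#|X|) x := if x == x0 then 0 else u ord0 (enum_rank x).
have uN (u : 'rV[R]_#|X|) y :
    (u *m N) ord0 (enum_rank y) + \sum_x W x y * (h u x - h u y) = u ord0 k0.
  have -> : \sum_x W x y * (h u x - h u y) =
      \sum_(k < #|X|) W (enum_val k) y * h u (enum_val k) - h u y.
    rewrite -(big_enum_val (fun x => W x y * h u x)) -[X in _ - X]mul1r -(W1 y).
    by rewrite mulr_suml -sumrB; apply: eq_bigr => x _; ring.
  rewrite !mxE addrA -big_split/= (bigD1 k0)//= !mxE eqxx enum_rankK /h eqxx.
  rewrite mulr0 addr0 mulr1 -addrA -[RHS]addr0; congr (_ + _); apply/eqP.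
  rewrite subr_eq0; apply/eqP.
  transitivity (\sum_(k < #|X| | k != k0) u ord0 k * (k == enum_rank y)%:R).
    apply: eq_bigr => k kk0; rewrite !mxE (negbTE kk0) enum_rankK enum_valK.
    have -> : (enum_val k == x0) = false.
      by apply/negbTE; apply: contra kk0 => /eqP E; rewrite /k0 -E enum_valK.
    by ring.
  case: eqVneq => [->|yx0].
    by apply: big1 => k kk0; rewrite (negbTE kk0) mulr0.
  have yk : enum_rank y != k0 by rewrite (inj_eq enum_rank_inj).
  rewrite (bigD1 (enum_rank y))//= eqxx mulr1 big1 ?addr0//.
  by move=> k /andP[_ /negbTE ->]; rewrite mulr0.
have Nu : N \in unitmx.
  rewrite -row_free_unit -kermx_eq0; apply/eqP/row_matrixP => i; rewrite row0.
  set u := row i _.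
  have uN0 : u *m N = 0 by rewrite /u -row_mul mulmx_ker row0.
  have [|c0 hc] := harmonic_const R X x0 W (h u) (u ord0 k0) W0.
    by move=> y; rewrite -(uN u y) uN0 mxE add0r.
  apply/rowP => k; rewrite [RHS]mxE.
  have [->//|kk0] := eqVneq k k0.
  have := hc (enum_val k); rewrite /h eqxx enum_valK.
  by case: eqVneq => // E; case/eqP: kk0; rewrite /k0 -E enum_valK.
pose phi : 'rV[R]_#|X| := \row_l \sum_x W x (enum_val l) * f x (enum_val l).
pose u := phi *m invmx N.
exists (u ord0 k0); exists (h u) => y.
rewrite -(uN u y) /u mulmxKV// mxE enum_rankK -big_split/=.
by apply: eq_bigr => x _; ring.
Qed.

(** * Sums over paths, the martingale estimate and the law of large numbers *)

Definition path_sum (R : realType) (X : finType) (f : X -> X -> R) (n : nat)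
    (x : {ffun 'I_n.+1 -> X}) : R :=
  \sum_(k < n) f (x (lift ord0 k)) (x (widen_ord (leqnSn n) k)).
Arguments path_sum {R X} f n x.

(** The new state is appended at the end, so that inductions on the length sum out the last state,
    conditionally on the past. *)
Definition path_rcons (X : finType) (n : nat) (y : {ffun 'I_n.+1 -> X}) (z : X) :
    {ffun 'I_n.+2 -> X} :=
  [ffun k => oapp y z (unlift ord_max k)].
Arguments path_rcons {X n} y z.

Lemma path_rcons_max (X : finType) (n : nat) (y : {ffun 'I_n.+1 -> X}) z :
  path_rcons y z ord_max = z.
Proof. by rewrite ffunE unlift_none. Qed.

Lemma path_rcons_lt (X : finType) (n : nat) (y : {ffun 'I_n.+1 -> X}) z
    (k : 'I_n.+2) (l : 'I_n.+1) :
  k = l :> nat -> path_rcons y z k = y l.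
Proof.
move=> kl; have -> : k = lift ord_max l.
  by apply: ord_inj; rewrite lift_max.
by rewrite ffunE liftK.
Qed.

Lemma path_rcons_surj (X : finType) (n : nat) (x : {ffun 'I_n.+2 -> X}) :
  x = path_rcons [ffun k => x (lift ord_max k)] (x ord_max).
Proof.
apply/ffunP => k; rewrite ffunE; case: unliftP => [j ->|->] //=.
by rewrite ffunE.
Qed.

Lemma sum_path_recr (R : realType) (X : finType) (n : nat)
    (G : {ffun 'I_n.+2 -> X} -> R) :
  \sum_x G x = \sum_y \sum_z G (path_rcons y z).
Proof.
rewrite pair_big/= (reindex (fun p => path_rcons p.1 p.2))//=.
exists (fun x => ([ffun k => x (lift ord_max k)], x ord_max)).
  move=> [y z] _ /=; rewrite path_rcons_max; congr pair; apply/ffunP => k.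
  by rewrite ffunE (path_rcons_lt X n y z _ k)// lift_max.
by move=> x _; rewrite -path_rcons_surj.
Qed.

Lemma sum_path0 (R : realType) (X : finType) (G : {ffun 'I_1 -> X} -> R) :
  \sum_x G x = \sum_a G [ffun=> a].
Proof.
rewrite (reindex (fun a : X => [ffun=> a]))//=.
exists (fun x => x ord0) => [a _|x _]; first by rewrite ffunE.
by apply/ffunP => k; rewrite ffunE (ord1 k).
Qed.

Lemma path_rcons_head (X : finType) n (y : {ffun 'I_n.+1 -> X}) z :
  path_rcons y z ord0 = y ord0.
Proof. exact: path_rcons_lt. Qed.

Lemma path_rcons_step (X : finType) n (y : {ffun 'I_n.+1 -> X}) z (k : 'I_n) :
  (path_rcons y z (lift ord0 (widen_ord (leqnSn n) k)) = y (lift ord0 k)) *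
  (path_rcons y z (widen_ord (leqnSn n.+1) (widen_ord (leqnSn n) k))
   = y (widen_ord (leqnSn n) k)).
Proof. by split; apply: path_rcons_lt. Qed.

Lemma path_rcons_last (X : finType) n (y : {ffun 'I_n.+1 -> X}) z :
  (path_rcons y z (lift ord0 ord_max) = z) *
  (path_rcons y z (widen_ord (leqnSn n.+1) ord_max) = y ord_max).
Proof.
split; last by apply: path_rcons_lt.
rewrite -[RHS](path_rcons_max X n y z); congr (path_rcons _ _ _).
exact: val_inj.
Qed.

Lemma path_sum_rcons (R : realType) (X : finType) (f : X -> X -> R) n
    (y : {ffun 'I_n.+1 -> X}) z :
  path_sum f n.+1 (path_rcons y z) =
  path_sum f n y + f z (y ord_max).
Proof.
rewrite /path_sum big_ord_recr/= !path_rcons_last; congr (_ + _).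
by apply: eq_bigr => k _; rewrite !path_rcons_step.
Qed.

Lemma markov_prob_rcons (R : realType) (X : finType) (p : X -> R)
    (W : X -> X -> R) n (y : {ffun 'I_n.+1 -> X}) z :
  markov_prob p W (path_rcons y z) = markov_prob p W y * W z (y ord_max).
Proof.
rewrite /markov_prob path_rcons_head big_ord_recr/= !path_rcons_last mulrA.
congr (_ * _ * _).
by apply: eq_bigr => k _; rewrite !path_rcons_step.
Qed.

Lemma markov_prob0 (R : realType) (X : finType) (p : X -> R)
    (W : X -> X -> R) (x : {ffun 'I_1 -> X}) :
  markov_prob p W x = p (x ord0).
Proof. by rewrite /markov_prob big_ord0 mulr1. Qed.

Lemma path_sum0 (R : realType) (X : finType) (f : X -> X -> R)
    (x : {ffun 'I_1 -> X}) : path_sum f 0 x = 0.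
Proof. exact: big_ord0. Qed.

Lemma markov_prob_ge0 (R : realType) (X : finType) (p : X -> R)
    (W : X -> X -> R) n (x : {ffun 'I_n.+1 -> X}) :
  (forall a, 0 <= p a) -> (forall a b, 0 <= W a b) -> 0 <= markov_prob p W x.
Proof. by move=> p0 W0; rewrite mulr_ge0// prodr_ge0. Qed.

Lemma markov_prob_gt0 (R : realType) (X : finType) (p : X -> R)
    (W : X -> X -> R) n (x : {ffun 'I_n.+1 -> X}) :
  (forall a, 0 < p a) -> (forall a b, 0 < W a b) -> 0 < markov_prob p W x.
Proof. by move=> p0 W0; rewrite mulr_gt0// prodr_gt0. Qed.

Lemma markov_prob_exp (R : realType) (X : finType) (p : X -> R)
    (W : X -> X -> R) n (x : {ffun 'I_n.+1 -> X}) :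
  (forall a b, 0 < W a b) ->
  markov_prob p W x =
  p (x ord0) * expR (path_sum (fun a b => ln (W a b)) n x).
Proof.
move=> W0; rewrite /markov_prob expR_sum; congr (_ * _).
by apply: eq_bigr => k _; rewrite lnK// posrE.
Qed.

(** Summing out the last state against the left eigenvector [v] yields one factor [l] per step. *)
Lemma markov_eigen_sum (R : realType) (X : finType) (p v : X -> R)
    (A : X -> X -> R) (l : R) n :
  (forall y, \sum_x v x * A x y = l * v y) ->
  \sum_(x : {ffun 'I_n.+1 -> X}) markov_prob p A x * v (x ord_max) =
  l ^+ n * \sum_a p a * v a.
Proof.
move=> vA; elim: n => [|n IH].
  rewrite sum_path0 mul1r; apply: eq_bigr => a _.
  by rewrite markov_prob0 !ffunE.
rewrite sum_path_recr exprS -mulrA -IH mulr_sumr; apply: eq_bigr => y _.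
rewrite mulrCA -vA mulr_sumr; apply: eq_bigr => z _.
by rewrite markov_prob_rcons path_rcons_max; ring.
Qed.

Lemma markov_prob_sum (R : realType) (X : finType) (p : X -> R)
    (W : X -> X -> R) n :
  \sum_a p a = 1 -> (forall y, \sum_x W x y = 1) ->
  \sum_(x : {ffun 'I_n.+1 -> X}) markov_prob p W x = 1.
Proof.
move=> p1 W1; have H := markov_eigen_sum R X p (fun=> 1) W 1 n.
transitivity (1 ^+ n * \sum_a p a * 1); last first.
  by under eq_bigr do rewrite mulr1; rewrite p1 expr1n mulr1.
rewrite -H; first by under [RHS]eq_bigr do rewrite mulr1.
by move=> y; under eq_bigr do rewrite mul1r; rewrite W1 mulr1.
Qed.

(* The increments are orthogonal: [path_sum D] is a martingale. *)
Lemma markov_martingale_var (R : realType) (X : finType) (p : X -> R)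
    (W D : X -> X -> R) (K : R) n :
  (forall a, 0 <= p a) -> (forall a b, 0 <= W a b) ->
  \sum_a p a = 1 -> (forall y, \sum_x W x y = 1) ->
  (forall y, \sum_x W x y * D x y = 0) -> (forall x y, `|D x y| <= K) ->
  \sum_(x : {ffun 'I_n.+1 -> X}) markov_prob p W x * path_sum D n x ^+ 2
  <= n%:R * K ^+ 2.
Proof.
move=> p0 W0 p1 W1 D0 DK; elim: n => [|n IH].
  by rewrite mul0r sumr_le0// => x _; rewrite path_sum0 expr0n mulr0.
rewrite sum_path_recr -natr1 mulrDl mul1r.
have M1 : \sum_(x : {ffun 'I_n.+1 -> X}) markov_prob p W x * K ^+ 2 = K ^+ 2.
  by rewrite -mulr_suml markov_prob_sum// mul1r.
apply: le_trans (lerD IH (lexx _)); rewrite -[X in _ <= _ + X]M1 -big_split/=.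
apply: ler_sum => y _; set m := markov_prob _ _ y; set S := path_sum _ _ y.
have m0 : 0 <= m by exact: markov_prob_ge0.
under eq_bigr do rewrite markov_prob_rcons path_sum_rcons -/m -/S.
clearbody m S.
(* In the expanded square the cross term carries the conditional mean of [D], which is zero. *)
have -> : \sum_z m * W z (y ord_max) * (S + D z (y ord_max)) ^+ 2 =
    m * S ^+ 2 * (\sum_z W z (y ord_max)) +
    m * S *+ 2 * (\sum_z W z (y ord_max) * D z (y ord_max)) +
    m * (\sum_z W z (y ord_max) * D z (y ord_max) ^+ 2).
  rewrite !mulr_sumr -!big_split/=; apply: eq_bigr => z _.
  by ring.
rewrite D0 W1 mulr0 mulr1 addr0 lerD2l ler_wpM2l//.
apply: (@le_trans _ _ (\sum_z W z (y ord_max) * K ^+ 2)).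
  apply: ler_sum => z _; apply: ler_wpM2l => //.
  by rewrite -real_normK ?num_real// lerXn2r ?nnegrE// (le_trans _ (DK z (y
    ord_max))).
by rewrite -mulr_suml W1 mul1r.
Qed.

Lemma path_sum_coboundary (R : realType) (X : finType) (f : X -> X -> R)
    (h : X -> R) (c : R) n (x : {ffun 'I_n.+1 -> X}) :
  path_sum (fun a b => f a b + h a - h b - c) n x =
  path_sum f n x + h (x ord_max) - h (x ord0) - n%:R * c.
Proof.
elim: n x => [|n IH] x.
  by rewrite !path_sum0 (ord1 ord_max); ring.
rewrite (path_rcons_surj X n x) !path_sum_rcons IH path_rcons_max path_rcons_head.
by rewrite -natr1; ring.
Qed.

(** Adding the corrector turns the centered sum into a martingale at the cost of a boundary term
    bounded by [2 * H]; Chebyshev's inequality is then applied to the martingale. *)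
Lemma markov_lln (R : realType) (X : finType) (p : X -> R)
    (W f : X -> X -> R) (c e eta : R) :
  (forall a, 0 <= p a) -> (forall a b, 0 <= W a b) ->
  \sum_a p a = 1 -> (forall y, \sum_x W x y = 1) ->
  has_drift W f c -> 0 < e -> 0 < eta ->
  exists n0 : nat, forall n, (n0 <= n)%N ->
    \sum_(x : {ffun 'I_n.+1 -> X} | n%:R * e < `|path_sum f n x - n%:R * c|)
       markov_prob p W x <= eta.
Proof.
move=> p0 W0 p1 W1 [h fh] e0 eta0.
pose D a b := f a b + h a - h b - c.
have [K K0 hK] := fin_bounded R (X * X)%type (fun q => D q.1 q.2).
have [H H0 hH] := fin_bounded R X h.
have WD y : \sum_x W x y * D x y = 0.
  rewrite /D; under eq_bigr do rewrite mulrBr.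
  by rewrite sumrB fh -mulr_suml W1 mul1r subrr.
(* The first bound makes the boundary term at most half of the deviation [n%:R * e], the second
   makes the Chebyshev quotient at most [eta], and the summand 1 makes [n] positive. *)
exists (Num.bound (4 * H / e) + Num.bound (4 * K ^+ 2 / (e ^+ 2 * eta)) + 1)%N.
move=> n nn0.
have n1 : 0 < n%:R :> R.
  by rewrite ltr0n (leq_trans _ nn0)// addn1.
have nb (b : R) : (Num.bound b <= n)%N -> 0 <= b -> b <= n%:R.
  move=> bn b0; apply: le_trans (ltW (archi_boundP b0)) _.
  by rewrite ler_nat.
have nH : 4 * H <= n%:R * e.
  rewrite -ler_pdivrMr//; apply: nb; last by rewrite divr_ge0 ?mulr_ge0// ltW.
  by rewrite (leq_trans _ nn0)// -addnA leq_addr.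
have nK : 4 * K ^+ 2 <= n%:R * (e ^+ 2 * eta).
  have ee : 0 < e ^+ 2 * eta by rewrite mulr_gt0// exprn_gt0.
  rewrite -ler_pdivrMr//; apply: nb; last by rewrite divr_ge0 ?mulr_ge0
    ?sqr_ge0// ltW.
  by apply: leq_trans nn0; rewrite addn1; apply: leqW; rewrite leq_addl.
pose N2 := (n%:R * e / 2) ^+ 2.
have N20 : 0 < N2 by rewrite exprn_gt0// divr_gt0// mulr_gt0.
apply: (@le_trans _ _ (\sum_(x : {ffun 'I_n.+1 -> X})
   markov_prob p W x * path_sum D n x ^+ 2 / N2)).
  rewrite big_mkcond/=; apply: ler_sum => x _.
  have m0 : 0 <= markov_prob p W x by exact: markov_prob_ge0.
  case: ifPn => [bad|_]; last by rewrite mulr_ge0 ?invr_ge0 ?(ltW N20)//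
    mulr_ge0// sqr_ge0.
  rewrite ler_pdivlMr// ler_wpM2l// /N2.
  rewrite -[leRHS]real_normK ?num_real// lerXn2r ?nnegrE//.
    by rewrite divr_ge0// mulr_ge0// ltW.
  rewrite /D path_sum_coboundary.
  have := hH (x ord_max); have := hH (x ord0).
  move: bad; set S := path_sum _ _ _; set a := h _; set b := h _.
  rewrite !ler_norml => bad /andP[a1 a2] /andP[b1 b2].
  have [S0|S0] := leP 0 (S - n%:R * c).
    by rewrite (ger0_norm S0) in bad; apply: le_trans (ler_norm _); lra.
  rewrite (ltr0_norm S0) in bad.
  by rewrite -normrN; apply: le_trans (ler_norm _); lra.
rewrite -mulr_suml ler_pdivrMr//.
apply: le_trans (markov_martingale_var R X p W D K n p0 W0 p1 W1 WD _) _.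
  by move=> x y; exact: (hK (x, y)).
have -> : eta * N2 = n%:R * (n%:R * (e ^+ 2 * eta) / 4) by rewrite /N2; field.
rewrite ler_pM2l//; lra.
Qed.

(** * Tilted chains *)

(** The vector [nu] merges order and weights: its total mass is [a - 1] and its direction is the
    distribution on [J]. The exponent is linear in [nu], and [nu = 0] gives back [P]. *)
Definition tilted (R : realType) (X J : finType) (P : X -> X -> R)
    (Q : J -> X -> X -> R) (nu : J -> R) (x y : X) : R :=
  P x y * expR (\sum_j nu j * (ln (P x y) - ln (Q j x y))).
Arguments tilted {R X J} P Q nu x y.

(* Locked, since conversion between two spectral radii unfolds [sup]. *)
HB.lock Definition logrho (R : realType) (X J : finType) (P : X -> X -> R)
    (Q : J -> X -> X -> R) (nu : J -> R) : R :=
  ln (spectral_radius (mx_of_fun (tilted P Q nu))).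
Arguments logrho {R X J} P Q nu.

Lemma tilted_gt0 (R : realType) (X J : finType) (P : X -> X -> R)
    (Q : J -> X -> X -> R) (nu : J -> R) x y :
  (forall x y, 0 < P x y) -> 0 < tilted P Q nu x y.
Proof. by move=> P0; rewrite mulr_gt0// expR_gt0. Qed.

Lemma logrho0 (R : realType) (X J : finType) (x0 : X) (P : X -> X -> R)
    (Q : J -> X -> X -> R) :
  (forall x y, 0 < P x y) -> (forall y, \sum_x P x y = 1) ->
  logrho P Q (fun=> 0) = 0.
Proof.
move=> P0 P1; rewrite logrho.unlock.
have -> : tilted P Q (fun=> 0) = P.
  apply/funext => x; apply/funext => y; rewrite /tilted big1 ?expR0 ?mulr1//.
  by move=> j _; rewrite mul0r.
by rewrite (spectral_radius_stoch R X x0)// ln1.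
Qed.

Lemma ler_ln_mulexp (R : realType) (a b f : R) :
  0 < a -> 0 < b -> a <= expR f * b -> ln a <= ln b + f.
Proof.
move=> a0 b0 ab; rewrite -[X in _ + X]expRK -lnM ?posrE ?expR_gt0//.
by rewrite ler_ln ?posrE ?mulr_gt0 ?expR_gt0// mulrC.
Qed.

(** Entrywise, the two tilted matrices differ by a factor of at most [expR (L * e)], and the
    spectral radius is monotone and homogeneous. *)
Lemma logrho_lipschitz (R : realType) (X J : finType) (x0 : X)
    (P : X -> X -> R) (Q : J -> X -> X -> R) :
  (forall x y, 0 < P x y) ->
  exists2 L, 0 <= L &
  forall nu nu' e, 0 <= e -> (forall j, `|nu j - nu' j| <= e) ->
    logrho P Q nu <= logrho P Q nu' + L * e.
Proof.
move=> P0.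
have [K K0 hK] := fin_bounded R (J * (X * X))%type
  (fun q => ln (P q.2.1 q.2.2) - ln (Q q.1 q.2.1 q.2.2)).
exists (#|J|%:R * K); first by rewrite mulr_ge0.
move=> nu nu' e e0 He.
have T0 n x y : 0 < tilted P Q n x y by exact: tilted_gt0.
have [r0 _] := perron_spectral_radius R X x0 _ (T0 nu).
have [r0' _] := perron_spectral_radius R X x0 _ (T0 nu').
pose f := #|J|%:R * K * e.
rewrite logrho.unlock; apply: ler_ln_mulexp r0 r0' _; rewrite -/f.
apply: (spectral_radius_scale_le R X x0) => // x y.
rewrite /tilted mulrCA ler_pM2l// -expRD ler_expR -lerBlDr -sumrB.
apply: (@le_trans _ _ (\sum_(j : J) K * e)).
  apply: ler_sum => j _; rewrite -mulrBl.
  apply: le_trans (ler_norm _) _; rewrite normrM mulrC ler_pM//.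
  exact: (hK (j, (x, y))).
by rewrite sumr_const /f -mulrA mulr_natl.
Qed.

(** The bound [expR (- u) >= 1 - u] gives [expR u * (1 - u) <= 1]; the polynomial on the right,
    multiplied by [1 - u], is at least 1 in this range. *)
Lemma expR_le_quadratic (R : realType) (u : R) :
  `|u| <= 1 / 2 -> expR u <= 1 + u + 2 * u ^+ 2.
Proof.
rewrite ler_norml => /andP[u1 u2].
have u10 : 0 < 1 - u by lra.
have H : expR u * (1 - u) <= 1.
  rewrite -[leRHS](expRxMexpNx_1 u) ler_pM2l ?expR_gt0//.
  by have := expR_ge1Dx (- u).
rewrite -(ler_pM2r u10) (le_trans H)// -subr_ge0.
have -> : (1 + u + 2 * u ^+ 2) * (1 - u) - 1 = u ^+ 2 * (1 - 2 * u) by ring.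
by rewrite mulr_ge0 ?sqr_ge0//; lra.
Qed.

(** The Doob transform: for a left eigenvector [v] the denominator is the sum of the numerators over
    [x], so the result is a transition matrix. *)
Definition doob (R : realType) (X : finType) (A : X -> X -> R) (v : X -> R)
    (l : R) (x y : X) : R := v x * A x y / (l * v y).
Arguments doob {R X} A v l x y.

Lemma doob_gt0 (R : realType) (X : finType) (A : X -> X -> R) (v : X -> R)
    (l : R) x y :
  (forall x y, 0 < A x y) -> (forall x, 0 < v x) -> 0 < l ->
  0 < doob A v l x y.
Proof. by move=> A0 v0 l0; rewrite divr_gt0 ?mulr_gt0. Qed.

Lemma doob_stoch (R : realType) (X : finType) (A : X -> X -> R) (v : X -> R)
    (l : R) :
  (forall x, 0 < v x) -> 0 < l -> (forall y, \sum_x v x * A x y = l * v y) ->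
  forall y, \sum_x doob A v l x y = 1.
Proof.
by move=> v0 l0 vA y; rewrite /doob -mulr_suml vA divff// gt_eqF// mulr_gt0.
Qed.

(* The test vector [v * exp (t h)], with [h] the Poisson corrector of [g], is
   a super-eigenvector of the perturbed matrix up to second order. *)
Lemma spectral_radius_perturb (R : realType) (X : finType) (x0 : X)
    (A : X -> X -> R) (v : X -> R) (l : R) (g : X -> X -> R) (c : R) :
  (forall x y, 0 < A x y) -> (forall x, 0 < v x) -> 0 < l ->
  (forall y, \sum_x v x * A x y = l * v y) ->
  has_drift (doob A v l) g c ->
  exists2 K, 0 <= K &
  forall t, 0 <= t -> t * K <= 1 / 2 ->
    spectral_radius (mx_of_fun (fun x y => A x y * expR (t * g x y))) <=
    expR (t * c + 2 * (t * K) ^+ 2) * l.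
Proof.
move=> A0 v0 l0 vA [h gh].
pose m x y := g x y + h x - h y.
have [K K0 hK] := fin_bounded R (X * X)%type (fun q => m q.1 q.2).
exists K => // t t0 tK.
apply: (spectral_radius_le R X x0 _ (fun x => v x * expR (t * h x))).
- by move=> x y; rewrite mulr_gt0// expR_gt0.
- by move=> x; rewrite mulr_gt0// expR_gt0.
move=> y.
have -> : \sum_x v x * expR (t * h x) * (A x y * expR (t * g x y)) =
    l * (v y * expR (t * h y)) * \sum_x doob A v l x y * expR (t * m x y).
  rewrite mulr_sumr; apply: eq_bigr => x _; rewrite /doob /m.
  have -> : t * (g x y + h x - h y) = t * g x y + t * h x - t * h y by ring.
  rewrite !expRD expRN; field.
  by rewrite !gt_eqF ?expR_gt0.
rewrite [leLHS]mulrC -[leRHS]mulrA ler_pM2r ?mulr_gt0 ?expR_gt0//.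
have W0 x : 0 < doob A v l x y by exact: doob_gt0.
apply: (@le_trans _ _ (\sum_x doob A v l x y *
    (1 + t * m x y + 2 * (t * K) ^+ 2))).
  apply: ler_sum => x _; rewrite ler_pM2l//.
  have tm : `|t * m x y| <= t * K.
    by rewrite normrM ger0_norm// ler_wpM2l//; exact: (hK (x, y)).
  apply: le_trans (expR_le_quadratic _ _ (le_trans tm tK)) _.
  rewrite lerD2l ler_pM2l// -real_normK ?num_real// lerXn2r ?nnegrE//.
  by rewrite mulr_ge0.
have -> : \sum_x doob A v l x y * (1 + t * m x y + 2 * (t * K) ^+ 2) =
   (\sum_x doob A v l x y) * (1 + 2 * (t * K) ^+ 2) +
   t * \sum_x doob A v l x y * m x y.
  rewrite mulr_suml mulr_sumr -big_split/=; apply: eq_bigr => x _; ring.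
rewrite (doob_stoch R X A v l v0 l0 vA) gh mul1r.
by rewrite addrAC -addrA expR_ge1Dx.
Qed.

(** Evaluated at a minimum of the corrector, the Poisson equation bounds [d] below by a one-step
    relative entropy, which is nonnegative by [ln u <= u - 1]. *)
Lemma drift_relative_entropy_ge0 (R : realType) (X : finType) (x0 : X)
    (W P : X -> X -> R) (d : R) :
  (forall x y, 0 < W x y) -> (forall y, \sum_x W x y = 1) ->
  (forall x y, 0 < P x y) -> (forall y, \sum_x P x y = 1) ->
  has_drift W (fun x y => ln (W x y) - ln (P x y)) d -> 0 <= d.
Proof.
move=> W0 W1 P0 P1 [h H].
have [y hy] := fin_argmin R X h x0.
rewrite -(H y).
apply: (@le_trans _ _ (\sum_x (W x y - P x y))).
  by rewrite sumrB W1 P1 subrr.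
apply: ler_sum => x _.
have : ln (P x y / W x y) <= P x y / W x y - 1.
  have := @le_ln1Dx R (P x y / W x y - 1).
  rewrite (addrC 1) subrK; apply.
  by rewrite ltrBrDl subrr divr_gt0.
rewrite ln_div ?posrE// => H1.
apply: (@le_trans _ _ (W x y * (1 - P x y / W x y))).
  by rewrite mulrBr mulr1 mulrCA divff ?mulr1// gt_eqF.
by rewrite ler_pM2l//; have := hy x; lra.
Qed.

Lemma sum_dist_le (R : realType) (J : finType) (nu nu' : J -> R) (e : R) :
  (forall j, `|nu j - nu' j| <= e) ->
  `|\sum_j nu j - \sum_j nu' j| <= #|J|%:R * e.
Proof.
move=> H; rewrite -sumrB; apply: le_trans (ler_norm_sum _ _ _) _.
apply: (@le_trans _ _ (\sum_(j : J) e)); first exact: ler_sum.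
by rewrite sumr_const mulr_natl.
Qed.

(** The hypothesis says that [F] below is nonnegative. At a minimizer [nu] over the truncated
    orthant, the partial derivatives of [F] are [- E j] and [F nu = c - dP - \sum_j nu j * E j].
    Comparing [nu] with 0 and with the vertices [N] at [j] gives the two final bounds. *)
Lemma tilted_chain (R : realType) (X J : finType) (x0 : X) (P : X -> X -> R)
    (Q : J -> X -> X -> R) (r c e : R) :
  (forall x y, 0 < P x y) -> (forall y, \sum_x P x y = 1) -> 0 < e ->
  (forall nu : J -> R, (forall j, 0 <= nu j) ->
     (\sum_j nu j) * r - logrho P Q nu <= c * (1 + \sum_j nu j)) ->
  exists (W : X -> X -> R) (dP : R) (dQ : J -> R),
  [/\ forall x y, 0 < W x y, forall y, \sum_x W x y = 1,
      has_drift W (fun x y => ln (W x y) - ln (P x y)) dP,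
      forall j, has_drift W (fun x y => ln (W x y) - ln (Q j x y)) (dQ j)
    & dP <= c /\ forall j, r - dQ j + dP <= c + e].
Proof.
move=> P0 P1 e0 Hc.
have c0 : 0 <= c.
  have := Hc (fun=> 0) (fun=> lexx _).
  by rewrite big1// mul0r (logrho0 R X J x0)// subrr addr0 mulr1.
(* Truncation makes the domain compact; [N * e = c + e] turns the bound [N * E j <= c] into
   [E j <= e]. *)
pose N := c / e + 1.
have N0 : 0 < N by rewrite ltr_wpDl// divr_ge0// ltW.
pose S := [set nu : J -> R | (forall j, 0 <= nu j) /\ \sum_j nu j <= N].
pose F nu := c + (\sum_j nu j) * (c - r) + logrho P Q nu.
have F0 nu : S nu -> 0 <= F nu.
  by move=> [nu0 _]; have := Hc nu nu0; rewrite /F; lra.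
have [L L0 hL] := logrho_lipschitz R X J x0 P Q P0.
have [|nu [nu0 nuN] j|nu Hnu|nu nu' d d0 Hd|nu [nu0 nuN] numin] :=
  lipschitz_argmin R J F (#|J|%:R * `|c - r| + L) N S.
- exists (fun=> 0); split; first by [].
  by rewrite big1// ltW.
- rewrite ger0_norm//; apply: le_trans nuN.
  by rewrite (bigD1 j)//= lerDl sumr_ge0.
- split=> [j|]; apply/ler_addgt0Pr => d d0.
    have [u [u0 _] /(_ j)] := Hnu d d0.
    by have := u0 j; rewrite ler_norml; lra.
  have JJ : 0 < #|J|%:R + 1 :> R by rewrite ltr_wpDl.
  have [|u [_ uN] /sum_dist_le] := Hnu (d / (#|J|%:R + 1)); first by rewrite
    divr_gt0.
  have : #|J|%:R * (d / (#|J|%:R + 1)) <= d.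
    by rewrite mulrCA ger_pMr// ler_pdivrMr// mul1r lerDl.
  by rewrite ler_norml; lra.
- have h1 := hL nu nu' d d0 Hd; have h2 := sum_dist_le R J nu nu' d Hd.
  have : (\sum_j nu j - \sum_j nu' j) * (c - r) <= #|J|%:R * `|c - r| * d.
    apply: le_trans (ler_norm _) _; rewrite normrM mulrAC.
    by rewrite ler_wpM2r.
  by rewrite /F; lra.
pose A := tilted P Q nu.
have A0 x y : 0 < A x y by exact: tilted_gt0.
have [l [l0 lognu [v v0 vA]]] : exists l, [/\ 0 < l, logrho P Q nu = ln l &
    exists2 v, (forall x, 0 < v x) & forall y, \sum_x v x * A x y = l * v y].
  have [l0 lv] := perron_spectral_radius R X x0 A A0.
  by exists (spectral_radius (mx_of_fun A)); rewrite logrho.unlock.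
pose W := doob A v l.
have W0 x y : 0 < W x y by exact: doob_gt0.
have W1 : forall y, \sum_x W x y = 1 by exact: doob_stoch.
have [dP hP] := drift_exists R X x0 W (fun x y => ln (W x y) - ln (P x y)) W0 W1.
have /choice[dQ hQ] : forall j, exists d, has_drift W (fun x y => ln (W x y) -
  ln (Q j x y)) d.
  by move=> j; exact: drift_exists.
exists W, dP, dQ; split=> //.
have hE j : has_drift W (fun x y => ln (P x y) - ln (Q j x y)) (dQ j - dP).
  rewrite -[X in _ - X]mul1r -mulNr.
  by apply: drift_ext (drift_lin _ _ _ _ _ (-1) _ _ (hQ j) hP) => x y; ring.
(* The logarithm of the Doob chain is that of the tilted matrix plus a coboundary minus [ln l];
   uniqueness of the drift turns this into an identity for [ln l]. *)
have lE : - ln l = dP - \sum_j nu j * (dQ j - dP).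
  apply: (drift_unique R X x0 W
    (fun x y => ln (v x) - ln (v y) - ln l)) => //.
    exact: drift_coboundary.
  rewrite -[X in _ - X]mul1r -mulNr.
  have := drift_lin _ _ _ _ _ (-1) _ _ hP (drift_sum _ _ _ _ _ nu _ hE).
  apply: drift_ext => x y.
  have -> : ln (W x y) = ln (v x) + ln (P x y) +
      \sum_j nu j * (ln (P x y) - ln (Q j x y)) - ln l - ln (v y).
    rewrite /W /doob /A /tilted ln_div ?posrE ?mulr_gt0 ?expR_gt0//.
    rewrite !lnM ?posrE ?mulr_gt0 ?expR_gt0// expRK; ring.
  ring.
pose E j := r - c - (dQ j - dP).
have FE : F nu = c - dP - \sum_j nu j * E j.
  rewrite /F lognu.
  have -> : \sum_j nu j * E j = (\sum_j nu j) * (r - c) - \sum_j nu j * (dQ j - dP).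
    by rewrite mulr_suml -sumrB; apply: eq_bigr => j _; rewrite /E; ring.
  by rewrite -(opprK (ln l)) lE; ring.
(* First-order optimality: if the direction [d] from [nu] to [u] had a positive gain [G], a small
   step along it would decrease [F], as [logrho] grows by at most its linear term plus a quadratic
   error. *)
have KKT u : S u -> \sum_j u j * E j <= \sum_j nu j * E j.
  move=> [u0 uN]; rewrite -subr_le0 -sumrB.
  pose d j := u j - nu j.
  rewrite (eq_bigr (fun j => d j * E j)); last by move=> j _; rewrite /d; ring.
  rewrite leNgt; apply/negP; set G := \sum_j _ => G0.
  have [K K0 hK] := spectral_radius_perturb R X x0 A v l _ _ A0 v0 l0 vA
    (drift_sum _ _ _ _ _ d _ hE).
  (* The three bounds keep [nu + t d] in the convex set [S], meet the range of the perturbation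
     bound, and make the quadratic error smaller than [t * G]. *)
  pose t := Num.min 1 (Num.min (1 / (2 * (K + 1))) (G / (4 * (K ^+ 2 + 1)))).
  have K1 : 0 < K + 1 by rewrite ltr_wpDl.
  have K2 : 0 < K ^+ 2 + 1 by rewrite ltr_wpDl// sqr_ge0.
  have t0 : 0 < t by rewrite !lt_min ltr01 !divr_gt0// mulr_gt0.
  have t1 : t <= 1 by rewrite ge_min lexx.
  have tK1 : t * (2 * (K + 1)) <= 1.
    rewrite -ler_pdivlMr; last by rewrite mulr_gt0.
    by rewrite /t !ge_min lexx orbT.
  have tG : t * (4 * (K ^+ 2 + 1)) <= G.
    rewrite -ler_pdivlMr; last by rewrite mulr_gt0.
    by rewrite /t !ge_min lexx !orbT.
  have tK : t * K <= 1 / 2 by lra.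
  pose w j := nu j + t * d j.
  have Sw : S w.
    split=> [j|].
      have -> : w j = (1 - t) * nu j + t * u j by rewrite /w /d; ring.
      by rewrite addr_ge0// mulr_ge0// ?subr_ge0// ltW.
    have -> : \sum_j w j = (1 - t) * (\sum_j nu j) + t * \sum_j u j.
      rewrite !mulr_sumr -big_split/=; apply: eq_bigr => j _; rewrite /w /d; ring.
    have -> : N = (1 - t) * N + t * N by ring.
    by rewrite lerD// ler_wpM2l// ?subr_ge0// ltW.
  have := hK t (ltW t0) tK.
  have -> : (fun x y => A x y * expR (t * \sum_j d j * (ln (P x y) - ln (Q j x
    y)))) =
      tilted P Q w.
    apply/funext => x; apply/funext => y; rewrite /A /tilted -mulrA -expRD.
    congr (_ * expR _); rewrite mulr_sumr -big_split/=; apply: eq_bigr => j _.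
    by rewrite /w; ring.
  have [lw [lw0 loglw ->]] : exists lw, [/\ 0 < lw, logrho P Q w = ln lw &
      spectral_radius (mx_of_fun (tilted P Q w)) = lw].
    have [lw0 _] := perron_spectral_radius R X x0 (tilted P Q w)
      (fun x y => tilted_gt0 _ _ _ _ _ _ x y P0).
    by exists (spectral_radius (mx_of_fun (tilted P Q w))); rewrite logrho.unlock.
  move=> /(ler_ln_mulexp _ _ _ _ lw0 l0); rewrite -loglw => H1.
  have := numin w Sw; rewrite /F.
  have -> : \sum_j w j = \sum_j nu j + t * \sum_j d j.
    by rewrite mulr_sumr -big_split.
  rewrite lognu => H2.
  have {}H2 : ln l <= t * (\sum_j d j) * (c - r) + logrho P Q w.
    by lra.
  have GE : G = (\sum_j d j) * (r - c) - \sum_j d j * (dQ j - dP).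
    by rewrite /G mulr_suml -sumrB; apply: eq_bigr => j _; rewrite /E; ring.
  have : t * G <= 2 * (t * K) ^+ 2 by rewrite GE; lra.
  have -> : 2 * (t * K) ^+ 2 = t * (2 * t * K ^+ 2) by ring.
  by rewrite ler_pM2l//; lra.
have Fnu : 0 <= F nu by apply: F0; split.
have nuE : 0 <= \sum_j nu j * E j.
  have := KKT (fun=> 0); rewrite big1; last by move=> j _; rewrite mul0r.
  by apply; split=> //; rewrite big1// ltW.
have dP0 : 0 <= dP by exact: (drift_relative_entropy_ge0 R X x0 W P).
split; first by lra.
move=> j.
(* Comparison with the vertex at [j] bounds [N * E j] by [\sum_j nu j * E j], which is at most [c]
   because [F nu] and [dP] are nonnegative. *)
have := KKT (fun i => if i == j then N else 0).
rewrite (bigD1 j)//= eqxx big1 ?addr0; last first.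
  by move=> i /negbTE ->; rewrite mul0r.
have Su : S (fun i => if i == j then N else 0).
  split=> [i|]; first by case: ifP => // _; exact: ltW.
  by rewrite (bigD1 j)//= eqxx big1 ?addr0// => i /negbTE ->.
move=> /(_ Su) NE.
have : E j <= e.
  rewrite -(ler_pM2l N0); have -> : N * e = c + e.
    by rewrite /N mulrDl mul1r divfK// gt_eqF.
  lra.
rewrite /E; lra.
Qed.

(** * Lower bound on the exponent *)

Lemma ln2_gt0 (R : realType) : 0 < ln (2 : R).
Proof. by rewrite ln_gt0// ltr1n. Qed.

Lemma pow2E (R : realType) (u : R) : 2 `^ u = expR (u * ln 2).
Proof. by rewrite /powR pnatr_eq0. Qed.

(** Since [g] sums to one, the factor [P ^ (a - 1)] can be distributed over the product, which
    produces the likelihood ratios of [tilted]. *)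
Lemma exponent_boundE (R : realType) (X J : finType) (P : X -> X -> R)
    (Q : J -> X -> X -> R) (r a : R) (g : J -> R) :
  (forall x y, 0 < P x y) -> (forall j x y, 0 < Q j x y) ->
  1 < a -> is_distr g ->
  exponent_bound P Q r a g =
  ((a - 1) * (r * ln 2) - logrho P Q (fun j => (a - 1) * g j)) /
  (a * ln 2).
Proof.
move=> P0 Q0 a1 [g0 g1]; rewrite /exponent_bound logrho.unlock.
have -> : (fun x x' => P x x' `^ a * \prod_j Q j x x' `^ ((1 - a) * g j)) =
    tilted P Q (fun j => (a - 1) * g j).
  apply/funext => x; apply/funext => y; rewrite /tilted.
  have -> : \prod_j Q j x y `^ ((1 - a) * g j) =
      expR (\sum_j (1 - a) * g j * ln (Q j x y)).
    by rewrite expR_sum; apply: eq_bigr => j _; rewrite /powR gt_eqF.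
  rewrite /powR gt_eqF// -[X in _ = X * _](lnK (P0 x y)) -!expRD; congr expR.
  have -> : \sum_j (a - 1) * g j * (ln (P x y) - ln (Q j x y)) =
      (a - 1) * ln (P x y) * (\sum_j g j) + \sum_j (1 - a) * g j * ln (Q j x y).
    by rewrite mulr_sumr -big_split/=; apply: eq_bigr => j _; ring.
  by rewrite g1; ring.
rewrite /log2; move: (ln (spectral_radius _)) => l.
have := ln2_gt0 R; move: (ln 2) => b b0; field.
by rewrite gt_eqF// !gt_eqF ?subr_gt0// (lt_trans _ a1).
Qed.

(** For fixed [a] the bound decreases with [logrho], which is Lipschitz and so has a minimum on the
    compact simplex. *)
Lemma exponent_bound_max (R : realType) (X J : finType) (x0 : X) (j0 : J)
    (P : X -> X -> R) (Q : J -> X -> X -> R) (r a : R) :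
  (forall x y, 0 < P x y) -> (forall j x y, 0 < Q j x y) -> 1 < a ->
  exists2 g : J -> R, is_distr g & forall g', is_distr g' ->
    exponent_bound P Q r a g' <= exponent_bound P Q r a g.
Proof.
move=> P0 Q0 a1.
have [L L0 hL] := logrho_lipschitz R X J x0 P Q P0.
have a10 : 0 < a - 1 by rewrite subr_gt0.
have [|g [g0 g1] j|g Hg|g g' d d0 Hd|g gd gmin] :=
  lipschitz_argmin R J (fun g => logrho P Q (fun j => (a - 1) * g j))
   (L * (a - 1)) 1 (@is_distr R J).
- exists (fun j => (j == j0)%:R); split=> [j|]; first by rewrite ler0n.
  by rewrite (bigD1 j0)//= eqxx big1 ?addr0// => j /negbTE ->.
- by rewrite ger0_norm// -g1 (bigD1 j)//= lerDl sumr_ge0.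
- split=> [j|].
    apply/ler_addgt0Pr => d d0.
    have [u [u0 _] /(_ j)] := Hg d d0.
    by have := u0 j; rewrite ler_norml; lra.
  have JJ : 0 < #|J|%:R + 1 :> R by rewrite ltr_wpDl.
  have H d : 0 < d -> `|\sum_j g j - 1| <= d.
    move=> d0.
    have [|u [_ u1] /sum_dist_le] := Hg (d / (#|J|%:R + 1)); first by rewrite
      divr_gt0.
    rewrite u1 => /le_trans; apply.
    by rewrite mulrCA ger_pMr// ler_pdivrMr// mul1r lerDl.
  apply/eqP; rewrite eq_le; apply/andP; split; apply/ler_addgt0Pr => d d0;
    by have := H d d0; rewrite ler_norml; lra.
- rewrite -mulrA; apply: hL => [|j]; first by rewrite mulr_ge0// ltW.
  by rewrite -mulrBr normrM gtr0_norm// ler_pM2l.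
exists g; first exact: gd.
move=> g' g'd.
rewrite (exponent_boundE _ _ _ _ _ r a g' P0 Q0 a1 g'd) (exponent_boundE _ _ _
  _ _ r a g P0 Q0 a1 gd).
rewrite ler_pM2r; last by rewrite invr_gt0 mulr_gt0 ?ln2_gt0// (lt_trans _ a1).
by rewrite lerD2l lerN2; exact: gmin.
Qed.

Lemma sublinearP (R : realType) (e : nat -> R) :
  sublinear e <-> forall d, 0 < d -> exists n0 : nat, forall n, (n0 <= n)%N ->
    `|e n| <= d * n%:R.
Proof.
rewrite /sublinear; split.
  move=> /eqoP H d d0; have [n0 _ Hn] := H d d0.
  by exists n0 => n nn0; have := Hn n nn0; rewrite /= [`|n%:R|]ger0_norm.
move=> H; apply/eqoP => d d0; have [n0 Hn] := H d d0.
by exists n0 => // n nn0; rewrite /= [`|n%:R|]ger0_norm//; exact: Hn.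
Qed.

(** Passage from inequalities at every length to one between exponents: a positive [x] is
    contradicted at a single large [n]. *)
Lemma sublinear_le0 (R : realType) (e1 e2 : nat -> R) (x K L : R) :
  sublinear e1 -> sublinear e2 -> 0 <= L ->
  (forall n, n%:R * x <= K + L * (`|e1 n| + `|e2 n|)) -> x <= 0.
Proof.
move=> /sublinearP H1 /sublinearP H2 L0 H; rewrite leNgt; apply/negP => x0.
pose d := x / (4 * (L + 1)).
have L1 : 0 < L + 1 by rewrite ltr_wpDl.
have d0 : 0 < d by rewrite divr_gt0// mulr_gt0.
have dL : L * d <= x / 4.
  have -> : d = x / 4 / (L + 1) by rewrite /d; field; rewrite gt_eqF.
  by rewrite mulrCA ger_pMr ?divr_gt0// ler_pdivrMr// mul1r lerDl.
have [n1 h1] := H1 d d0; have [n2 h2] := H2 d d0.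
pose n := (n1 + n2 + Num.bound (4 * `|K| / x) + 1)%N.
have {}h1 : `|e1 n| <= d * n%:R.
  by apply: h1; rewrite /n -!addnA leq_addr.
have {}h2 : `|e2 n| <= d * n%:R.
  by apply: h2; rewrite /n -!addnA addnCA leq_addr.
have n0 : 0 < n%:R :> R by rewrite ltr0n /n addn1.
have nK : 4 * `|K| <= n%:R * x.
  rewrite -ler_pdivrMr//; apply: le_trans (ltW (archi_boundP _)) _.
    by rewrite divr_ge0 ?mulr_ge0// ltW.
  by rewrite ler_nat /n addn1; apply: leqW; rewrite leq_addl.
have := H n.
have : L * (`|e1 n| + `|e2 n|) <= n%:R * x / 2.
  apply: (@le_trans _ _ (L * (2 * (d * n%:R)))).
    by rewrite ler_wpM2l//; lra.
  have -> : L * (2 * (d * n%:R)) = L * d * n%:R * 2 by ring.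
  have : L * d * n%:R <= x / 4 * n%:R by rewrite ler_pM2r.
  lra.
have := ler_norm K; have : 0 < n%:R * x by rewrite mulr_gt0.
lra.
Qed.

(** Weighted inequality of means, by the tangent line of the exponential at the mean [m]. *)
Lemma amgm_exp (R : realType) (J : finType) (g b : J -> R) :
  is_distr g -> expR (\sum_j g j * b j) <= \sum_j g j * expR (b j).
Proof.
move=> [g0 g1]; set m := \sum_j _.
have -> : \sum_j g j * expR (b j) = expR m * \sum_j g j * expR (b j - m).
  rewrite mulr_sumr; apply: eq_bigr => j _.
  by rewrite expRD expRN; field; rewrite gt_eqF// expR_gt0.
rewrite ler_peMr ?expR_ge0//.
apply: (@le_trans _ _ (\sum_j (g j + g j * b j - g j * m))).
  by rewrite sumrB big_split/= -mulr_suml g1 -/m mul1r addrK.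
apply: ler_sum => j _; have := expR_ge1Dx (b j - m) => h.
apply: (@le_trans _ _ (g j * (1 + (b j - m)))); first by lra.
by rewrite ler_wpM2l.
Qed.

(* A pointwise substitute for Hoelder's inequality: compare [ln p] with the
   threshold [t] plus the geometric mean of the [q j]. *)
Lemma renyi_split (R : realType) (J : finType) (g q : J -> R) (p a t : R) :
  is_distr g -> 0 < p -> (forall j, 0 < q j) -> 1 < a ->
  p <= expR t * (\sum_j g j * q j) +
       p * expR (\sum_j (a - 1) * g j * (ln p - ln (q j))) * expR (- (a - 1) * t).
Proof.
move=> gd p0 q0 a1; have [g0 g1] := gd.
pose D := \sum_j g j * (ln p - ln (q j)).
have DE : D = ln p - \sum_j g j * ln (q j).
  rewrite /D; under eq_bigr do rewrite mulrBr.
  by rewrite sumrB -mulr_suml g1 mul1r.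
have -> : \sum_j (a - 1) * g j * (ln p - ln (q j)) = (a - 1) * D.
  by rewrite /D mulr_sumr; apply: eq_bigr => j _; rewrite mulrA.
have S0 : 0 <= \sum_j g j * q j.
  by apply: sumr_ge0 => j _; rewrite mulr_ge0// ltW.
(* If [D <= t], then [p] is at most [expR t] times the geometric mean of the [q j], hence the
   arithmetic one; otherwise the last two exponentials have a product of at least 1. *)
have [Dt|tD] := leP D t.
  rewrite -[leLHS]addr0 lerD ?mulr_ge0 ?expR_ge0 ?(ltW p0)//.
  rewrite -{1}(lnK p0).
  have -> : ln p = D + \sum_j g j * ln (q j) by rewrite DE subrK.
  rewrite expRD ler_pM ?expR_ge0// ?ler_expR//.
  apply: le_trans (amgm_exp R J g _ gd) _.
  by apply: ler_sum => j _; rewrite lnK// posrE.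
rewrite -[leLHS]add0r lerD ?mulr_ge0 ?expR_ge0//.
rewrite -mulrA -expRD ler_peMr ?(ltW p0)// -[leLHS]expR0 ler_expR.
have -> : (a - 1) * D + - (a - 1) * t = (a - 1) * (D - t) by ring.
by rewrite mulr_ge0// subr_ge0 ltW.
Qed.

(** Log-likelihoods are additive along a path, so tilting the path law tilts the initial weights and
    each transition separately. *)
Lemma markov_prob_tilt (R : realType) (X J : finType) (p : X -> R)
    (P : X -> X -> R) (q : J -> X -> R) (Q : J -> X -> X -> R)
    (nu : J -> R) n (x : {ffun 'I_n.+1 -> X}) :
  (forall a, 0 < p a) -> (forall a b, 0 < P a b) ->
  (forall j a, 0 < q j a) -> (forall j a b, 0 < Q j a b) ->
  markov_prob p P x * expR (\sum_j nu j *
     (ln (markov_prob p P x) - ln (markov_prob (q j) (Q j) x))) =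
  markov_prob (fun a => p a * expR (\sum_j nu j * (ln (p a) - ln (q j a))))
    (tilted P Q nu) x.
Proof.
move=> p0 P0 q0 Q0.
have lnM0 (p' : X -> R) (W : X -> X -> R) : (forall a, 0 < p' a) ->
    (forall a b, 0 < W a b) -> ln (markov_prob p' W x) =
    ln (p' (x ord0)) + path_sum (fun a b => ln (W a b)) n x.
  by move=> p'0 W0; rewrite markov_prob_exp// lnM ?posrE ?expR_gt0// expRK.
under eq_bigr do rewrite !lnM0//.
rewrite [RHS]/markov_prob /tilted big_split/= -expR_sum.
rewrite {1}/markov_prob -!mulrA; congr (_ * _); rewrite mulrCA; congr (_ * _).
rewrite -expRD; congr expR; rewrite [X in _ = _ + X]exchange_big/= -big_split/=.
apply: eq_bigr => j _; rewrite -mulr_sumr -mulrDr sumrB /path_sum; congr (_ *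
  _); ring.
Qed.

Lemma markov_sum_le (R : realType) (X : finType) (x0 : X) (p v : X -> R)
    (A : X -> X -> R) (l : R) :
  (forall a, 0 < p a) -> (forall a b, 0 < A a b) -> (forall a, 0 < v a) ->
  (forall y, \sum_x v x * A x y = l * v y) ->
  exists2 C, 0 < C & forall n,
    \sum_(x : {ffun 'I_n.+1 -> X}) markov_prob p A x <= C * l ^+ n.
Proof.
move=> p0 A0 v0 vA; have [m hm] := fin_argmin R X v x0.
exists ((\sum_a p a * v a) / v m).
  by rewrite divr_gt0//; apply: sumr_fin_gt0 => // a; rewrite mulr_gt0.
move=> n; rewrite mulrAC ler_pdivlMr// mulrC mulr_sumr [leRHS]mulrC.
rewrite -(markov_eigen_sum R X p v A l n vA); apply: ler_sum => x _.
by rewrite mulrC ler_pM2l// markov_prob_gt0.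
Qed.

Lemma sc_achievable_ge_exponent_bound (R : realType) (X I J : finType) (x0 : X)
  (P0 : I -> X -> R) (P : I -> X -> X -> R)
  (Q0 : J -> X -> R) (Q : J -> X -> X -> R)
  (P0_full : forall i x, 0 < P0 i x) (Q0_full : forall j x, 0 < Q0 j x)
  (P_pos : forall i x2 x1, 0 < P i x2 x1)
  (Q_pos : forall j x2 x1, 0 < Q j x2 x1) (r s a : R) (i : I) (g : J -> R) :
  sc_achievable P0 P Q0 Q r s -> 1 < a -> is_distr g ->
  exponent_bound (P i) Q r a g <= s.
Proof.
move=> [T [Ttest [e1 e1s H1] [e2 e2s H2]]] a1 gd.
have a0 : 0 < a by exact: lt_trans a1.
have [g0 g1] := gd.
pose nu j := (a - 1) * g j.
pose A := tilted (P i) Q nu.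
have A0 x y : 0 < A x y by exact: tilted_gt0.
have [l [l0 lognu [v v0 vA]]] : exists l, [/\ 0 < l, logrho (P i) Q nu = ln l &
    exists2 v, (forall x, 0 < v x) & forall y, \sum_x v x * A x y = l * v y].
  have [l0 lv] := perron_spectral_radius R X x0 A A0.
  by exists (spectral_radius (mx_of_fun A)); rewrite logrho.unlock.
pose p' b := P0 i b * expR (\sum_j nu j * (ln (P0 i b) - ln (Q0 j b))).
have p'0 b : 0 < p' b by rewrite mulr_gt0// expR_gt0.
have [C C0 hC] := markov_sum_le R X x0 p' v A l p'0 A0 v0 vA.
rewrite (exponent_boundE _ _ _ _ _ r a g (P_pos i) Q_pos a1 gd) -/nu lognu.
rewrite -subr_le0.
have ln20 := ln2_gt0 R; set b2 := ln 2 in ln20 *.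
rewrite -(pmulr_rle0 _ ln20).
(* The constant [b2 = ln 2] pays for a sum of two equal terms and [ln C] for the prefactor of the
   path sum. *)
apply: (@sublinear_le0 R e1 e2 _ (b2 + `|ln C|) b2) => //; first exact: ltW.
move=> n.
(* Here [b] and [z] are the logarithms of the bounds on the type II error and on the tilted path
   sum. The threshold [t] equalizes [t + b] and [z - (a - 1) * t], with common value [w]. *)
pose b := (- n%:R * r + e1 n) * b2.
pose z := ln C + n%:R * ln l.
pose t := (z - b) / a.
pose w := (z + (a - 1) * b) / a.
have Cz : C * l ^+ n = expR z by rewrite /z expRD lnK ?posrE// expRM_natl lnK
  ?posrE.
have key : expR ((- n%:R * s + e2 n) * b2) <= expR (b2 + w).
  rewrite -pow2E; apply: le_trans (H2 n) _.
  apply: (@le_trans _ _ (accept_prob (P0 i) (P i) (T n))).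
    rewrite lerBlDr -lerBlDl.
    exact: (le_bigmax _ (fun i => 1 - accept_prob (P0 i) (P i) (T n))).
  have Qb : \sum_j g j * accept_prob (Q0 j) (Q j) (T n) <= expR b.
    apply: (@le_trans _ _ (\sum_j g j * expR b)); last by rewrite -mulr_suml g1
      mul1r.
    apply: ler_sum => j _; rewrite ler_wpM2l// /b -pow2E; apply: le_trans (H1 n).
    exact: (le_bigmax _ (fun j => accept_prob (Q0 j) (Q j) (T n))).
  apply: (@le_trans _ _ (expR t * expR b + expR z * expR (- (a - 1) * t))).
    apply: (@le_trans _ _ (expR t * (\sum_j g j * accept_prob (Q0 j) (Q j) (T n)) +
      (\sum_(x : {ffun 'I_n.+1 -> X}) markov_prob p' A x) * expR (- (a - 1) * t))).
      rewrite /accept_prob.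
      under [X in expR t * X]eq_bigr do rewrite mulr_sumr.
      rewrite [X in expR t * X]exchange_big/= mulr_sumr mulr_suml -big_split/=.
      apply: ler_sum => x _.
      have /andP[T0 T1] := Ttest n x.
      have m0 := markov_prob_gt0 R X (P0 i) (P i) n x (P0_full i) (P_pos i).
      have := renyi_split R J g (fun j => markov_prob (Q0 j) (Q j) x) _ a t gd
        m0 _ a1.
      move=> /(_ (fun j => markov_prob_gt0 R X _ _ n x (Q0_full j) (Q_pos j))).
      rewrite markov_prob_tilt// -/p' -/A => Hx.
      apply: le_trans (ler_wpM2l T0 Hx) _; rewrite mulrDr lerD//.
        rewrite mulrCA ler_pM2l ?expR_gt0// mulr_sumr le_eqVlt.
        by apply/orP; left; apply/eqP; apply: eq_bigr => j _; rewrite mulrCA.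
      rewrite ler_piMl//.
      by rewrite mulr_ge0 ?expR_ge0// ltW// markov_prob_gt0.
    rewrite lerD ?ler_pM2l ?expR_gt0// ler_pM2r ?expR_gt0//.
    by rewrite -Cz.
  rewrite -!expRD.
  have -> : t + b = w by rewrite /t /w; field; rewrite gt_eqF.
  have -> : z + - (a - 1) * t = w by rewrite /t /w; field; rewrite gt_eqF.
  have -> : expR (b2 + w) = 2 * expR w by rewrite expRD /b2 lnK// posrE.
  lra.
move: key; rewrite ler_expR.
have -> : n%:R * (b2 * (((a - 1) * (r * b2) - ln l) / (a * b2) - s)) =
    n%:R * (((a - 1) * (r * b2) - ln l) / a) - n%:R * s * b2.
  by field; rewrite !gt_eqF.
have wE : w = ln C / a - n%:R * (((a - 1) * (r * b2) - ln l) / a) + (a - 1) / a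
  * (e1 n * b2).
  by rewrite /w /z /b; field; rewrite gt_eqF.
have c1 : ln C / a <= `|ln C|.
  rewrite ler_pdivrMr//; apply: le_trans (ler_norm _) _.
  by rewrite ler_peMr// ltW.
have c2 : (a - 1) / a * (e1 n * b2) <= b2 * `|e1 n|.
  apply: le_trans (ler_norm _) _; rewrite normrM [`|e1 n * b2|]normrM
    (gtr0_norm ln20).
  have h1 : 0 <= (a - 1) / a by rewrite divr_ge0 ?subr_ge0// ltW.
  have h2 : (a - 1) / a <= 1 by rewrite ler_pdivrMr// mul1r gerBl.
  by rewrite (ger0_norm h1) mulrC [leRHS]mulrC ler_piMr// mulr_ge0// ltW.
have c3 : - (e2 n * b2) <= b2 * `|e2 n|.
  rewrite mulrC -mulrN ler_pM2l// -normrN; exact: ler_norm.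
rewrite wE; lra.
Qed.

(** * Construction of tests *)

Lemma expRN_eventually_le (R : realType) (e K : R) :
  0 < e -> 0 < K -> exists n0 : nat, forall n, (n0 <= n)%N ->
    expR (- (n%:R * e)) <= K^-1.
Proof.
move=> e0 K0; exists (Num.bound (K / e)) => n nn0.
rewrite expRN lef_pV2 ?posrE ?expR_gt0//.
apply: (@le_trans _ _ (n%:R * e)).
  rewrite -ler_pdivrMr//; apply: le_trans (ltW (archi_boundP _)) _.
    by rewrite divr_ge0// ltW.
  by rewrite ler_nat.
by apply: le_trans (expR_ge1Dx _); rewrite lerDr.
Qed.

(** Change of measure between two chains; the initial weights are cross-multiplied instead of
    divided. *)
Lemma markov_prob_ratio (R : realType) (X : finType) (p q : X -> R)
    (V W : X -> X -> R) n (x : {ffun 'I_n.+1 -> X}) :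
  (forall a b, 0 < V a b) -> (forall a b, 0 < W a b) ->
  markov_prob p V x * q (x ord0) =
  markov_prob q W x * p (x ord0) *
  expR (- path_sum (fun a b => ln (W a b) - ln (V a b)) n x).
Proof.
move=> V0 W0; rewrite !markov_prob_exp//.
have -> : path_sum (fun a b => ln (W a b) - ln (V a b)) n x =
    path_sum (fun a b => ln (W a b)) n x - path_sum (fun a b => ln (V a b)) n x.
  by rewrite /path_sum -sumrB.
rewrite opprB expRD expRN; field; rewrite gt_eqF//; exact: expR_gt0.
Qed.

(** Paths typical for [W] are accepted with probability [k]. They carry at least half of the mass of
    [W], and on them the likelihoods under [P] and [Q j] are those of [W] reduced at the rates [dP]
    and [dQ j] up to [d]. *)
Lemma single_null_test (R : realType) (X J : finType) (x0 : X) (p : X -> R)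
    (P : X -> X -> R) (q : J -> X -> R) (Q : J -> X -> X -> R) (r c e C : R) :
  (forall a, 0 < p a) -> \sum_a p a = 1 ->
  (forall x y, 0 < P x y) -> (forall y, \sum_x P x y = 1) ->
  (forall j a, 0 < q j a) -> (forall j x y, 0 < Q j x y) ->
  (forall j a, q j a <= C * p a) -> 0 < e ->
  (forall nu : J -> R, (forall j, 0 <= nu j) ->
     (\sum_j nu j) * r - logrho P Q nu <= c * (1 + \sum_j nu j)) ->
  exists n0 : nat, forall n, (n0 <= n)%N ->
    exists T : {ffun 'I_n.+1 -> X} -> R, [/\ is_test T,
      forall j, accept_prob (q j) (Q j) T <= C * expR (- (n%:R * r)) &
      expR (- (n%:R * (c + e))) <= accept_prob p P T].
Proof.
move=> p0 p1 P0 P1 q0 Q0 qC e0 Hc.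
have C0 (j : J) : 0 < C.
  by rewrite -(pmulr_lgt0 _ (p0 x0)); apply: lt_le_trans (qC j x0).
have half : 1 - 1 / 2 = 1 / 2 :> R by field.
(* The loss is [2 * d] in [k], one [d] for typicality with respect to [P], and one [d] for the
   factor [1 / 2]. *)
pose d := e / 4.
have d0 : 0 < d by rewrite divr_gt0.
have [W [dP [dQ [W0 W1 hP hQ [dPc dQc]]]]] :=
  tilted_chain R X J x0 P Q r c d P0 P1 d0 Hc.
(* [None] stands for the null hypothesis, so that one union bound covers all the likelihood
   ratios. *)
pose f (o : option J) x y := ln (W x y) -
  ln (if o is Some j then Q j x y else P x y).
pose D (o : option J) := if o is Some j then dQ j else dP.
have hD o : has_drift W (f o) (D o).
  by case: o => [j|]; [exact: hQ|exact: hP].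
pose N : R := #|{: option J}|%:R.
have N0 : 0 < N by rewrite ltr0n; apply/card_gt0P; exists None.
pose eta := (2 * N)^-1.
have eta0 : 0 < eta by rewrite invr_gt0 mulr_gt0.
pose bad n o (x : {ffun 'I_n.+1 -> X}) :=
  n%:R * d < `|path_sum (f o) n x - n%:R * D o|.
have /choice[m hm] : forall o, exists n0 : nat, forall n, (n0 <= n)%N ->
    \sum_(x : {ffun 'I_n.+1 -> X} | bad n o x) markov_prob p W x <= eta.
  move=> o; apply: markov_lln => //.
  - by move=> a; exact: ltW.
  - by move=> a b; exact: ltW.
have [n2 hn2] := expRN_eventually_le R d 2 d0 (ltr0n _ 2).
exists (\max_o m o + n2)%N => n nn0.
have nm o : (m o <= n)%N.
  by apply: leq_trans nn0; apply: leq_trans (leq_addr _ _); exact: leq_bigmax.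
have nn2 : (n2 <= n)%N by apply: leq_trans nn0; rewrite leq_addl.
pose good (x : {ffun 'I_n.+1 -> X}) := [forall o, ~~ bad n o x].
have Wgood : 1 / 2 <= \sum_(x : {ffun 'I_n.+1 -> X} | good x) markov_prob p W x.
  have W_ge0 (x : {ffun 'I_n.+1 -> X}) : 0 <= markov_prob p W x.
    by rewrite ltW// markov_prob_gt0.
  have : \sum_(x : {ffun 'I_n.+1 -> X} | ~~ good x) markov_prob p W x <= 1 / 2.
    apply: (@le_trans _ _ (\sum_o
      \sum_(x : {ffun 'I_n.+1 -> X} | bad n o x) markov_prob p W x)).
      under [leRHS]eq_bigr do rewrite big_mkcond.
      rewrite exchange_big/= big_mkcond/=; apply: ler_sum => x _.
      case: ifPn => [|_]; last by apply: sumr_ge0 => o _; case: ifP.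
      rewrite negb_forall => /existsP[b]; rewrite negbK => bo.
      by rewrite (bigD1 b)//= bo lerDl sumr_ge0// => o' _; case: ifP.
    apply: (@le_trans _ _ (\sum_(o : option J) eta)).
      by apply: ler_sum => o _; exact: hm.
    have -> : 1 / 2 = N * eta by rewrite /eta; field; rewrite gt_eqF.
    by rewrite sumr_const mulr_natl.
  have := markov_prob_sum R X p W n p1 W1.
  rewrite (bigID good)/= => /(canRL (addrK _)) -> H.
  by rewrite lerBrDl -lerBrDr half.
have goodP x : good x -> forall o, `|path_sum (f o) n x - n%:R * D o| <= n%:R * d.
  by move=> /forallP H o; have := H o; rewrite /bad -leNgt.
(* This probability lowers the type II error to the rate [r], by [r - dQ j + dP <= c + d]; it is at
   most 1 because [dP <= c]. *)
pose k := expR (- (n%:R * (c - dP + 2 * d))).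
have k0 : 0 <= k by exact: expR_ge0.
have k1 : k <= 1.
  by rewrite /k -[leRHS]expR0 ler_expR oppr_le0 mulr_ge0// addr_ge0 ?subr_ge0//
    mulr_ge0// ltW.
exists (fun x => if good x then k else 0); split.
- by move=> x; case: ifP => _; rewrite ?k0 ?lexx ?ler01.
- move=> j; rewrite /accept_prob.
  apply: (@le_trans _ _ (\sum_x C * expR (- (n%:R * r)) * markov_prob p W x));
    last first.
    by rewrite -mulr_sumr markov_prob_sum// mulr1.
  apply: ler_sum => x _.
  have mW := markov_prob_gt0 R X p W n x p0 W0.
  case: ifP => gx; last by rewrite mul0r mulr_ge0 ?(ltW mW)// mulr_ge0
    ?expR_ge0// ltW// (C0 j).
  have := goodP x gx (Some j); rewrite ler_norml => /andP[g1 _].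
  set S := path_sum _ _ _ in g1.
  have H : markov_prob (q j) (Q j) x <= C * markov_prob p W x * expR (- S).
    rewrite -(ler_pM2r (p0 (x ord0))) (markov_prob_ratio R X (q j) p (Q j) W n
      x (Q0 j) W0).
    rewrite -/(f (Some j)) -/S.
    have -> : C * markov_prob p W x * expR (- S) * p (x ord0) =
      markov_prob p W x * (C * p (x ord0)) * expR (- S) by ring.
    by rewrite ler_pM2r ?expR_gt0// ler_pM2l.
  apply: le_trans (ler_wpM2l k0 H) _.
  have -> : k * (C * markov_prob p W x * expR (- S)) =
     C * (k * expR (- S)) * markov_prob p W x by ring.
  rewrite ler_pM2r// ler_pM2l ?(C0 j)// /k -expRD ler_expR.
  have := ler_wpM2l (ler0n R n) (dQc j).
  move: g1; rewrite /D; clear -S; clearbody S; lra.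
- have kd0 : 0 < k * expR (- (n%:R * (dP + d))) by apply: mulr_gt0; exact: expR_gt0.
  rewrite /accept_prob.
  apply: (@le_trans _ _ (k * expR (- (n%:R * (dP + d))) *
     \sum_(x : {ffun 'I_n.+1 -> X} | good x) markov_prob p W x)).
    apply: (@le_trans _ _ (k * expR (- (n%:R * (dP + d))) * (1 / 2))); last first.
      by rewrite (ler_pM2l kd0).
    have h2 := hn2 n nn2.
    apply: (@le_trans _ _ (k * expR (- (n%:R * (dP + d))) * expR (- (n%:R *
      d)))); last first.
      by rewrite (ler_pM2l kd0) mul1r.
    by rewrite /k -!expRD ler_expR /d; clear; lra.
  rewrite mulr_sumr big_mkcond/=; apply: ler_sum => x _.
  case: ifP => gx; last by rewrite mul0r.
  rewrite -mulrA ler_wpM2l//.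
  have := goodP x gx None; rewrite ler_norml => /andP[_ g2].
  rewrite -(ler_pM2r (p0 (x ord0))) (markov_prob_ratio R X p p P W n x P0 W0).
  rewrite -/(f None) [leRHS]mulrC -mulrA ler_pM2r; last first.
    by rewrite mulr_gt0// markov_prob_gt0.
  rewrite ler_expR; move: g2; rewrite /D; set S := path_sum _ _ _.
  clear -S; clearbody S; lra.
Qed.

Lemma type1_error_compl_ge (R : realType) (X I : finType) (P0 : I -> X -> R)
    (P : I -> X -> X -> R) n (T : {ffun 'I_n.+1 -> X} -> R) (s : R) :
  s <= 1 -> (forall i, s <= accept_prob (P0 i) (P i) T) ->
  s <= 1 - type1_error P0 P T.
Proof.
move=> s1 sT; rewrite lerBrDr -lerBrDl; apply: bigmax_le; first by rewrite subr_ge0.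
by move=> i _; rewrite lerB.
Qed.

(** The tests for the individual [i] are averaged. The type II bound survives averaging, and the
    acceptance probability under [P i] loses at most the factor [#|I|], absorbed by half of [e]. *)
Lemma composite_test (R : realType) (X I J : finType) (x0 : X) (i0 : I)
    (P0 : I -> X -> R) (P : I -> X -> X -> R)
    (Q0 : J -> X -> R) (Q : J -> X -> X -> R) (r c e C : R) :
  (forall i a, 0 < P0 i a) -> (forall i, \sum_a P0 i a = 1) ->
  (forall i x y, 0 < P i x y) -> (forall i y, \sum_x P i x y = 1) ->
  (forall j a, 0 < Q0 j a) -> (forall j x y, 0 < Q j x y) ->
  0 <= C -> (forall i j a, Q0 j a <= C * P0 i a) -> 0 <= c -> 0 < e ->
  (forall i (nu : J -> R), (forall j, 0 <= nu j) ->
     (\sum_j nu j) * r - logrho (P i) Q nu <= c * (1 + \sum_j nu j)) ->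
  exists n0 : nat, forall n, (n0 <= n)%N ->
    exists T : {ffun 'I_n.+1 -> X} -> R, [/\ is_test T,
      type2_error Q0 Q T <= C * expR (- (n%:R * r)) &
      expR (- (n%:R * (c + e))) <= 1 - type1_error P0 P T].
Proof.
move=> p0 p1 W0 W1 q0 V0 C0 qC c0 e0 Hc.
have e2 : 0 < e / 2 by rewrite divr_gt0.
have /choice[m hm] : forall i, exists n0 : nat, forall n, (n0 <= n)%N ->
    exists T : {ffun 'I_n.+1 -> X} -> R, [/\ is_test T,
      forall j, accept_prob (Q0 j) (Q j) T <= C * expR (- (n%:R * r)) &
      expR (- (n%:R * (c + e / 2))) <= accept_prob (P0 i) (P i) T].
  move=> i; exact: (single_null_test R X J x0 (P0 i) (P i) Q0 Q r c (e / 2) C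
    (p0 i) (p1 i) (W0 i) (W1 i) q0 V0 (qC i) e2 (Hc i)).
have I0 : 0 < #|I|%:R :> R by rewrite ltr0n; apply/card_gt0P; exists i0.
have [n2 hn2] := expRN_eventually_le R (e / 2) _ e2 I0.
exists (\max_i m i + n2)%N => n nn0.
have nm i : (m i <= n)%N.
  by apply: leq_trans nn0; apply: leq_trans (leq_addr _ _); exact: leq_bigmax.
have nn2 : (n2 <= n)%N by apply: leq_trans nn0; rewrite leq_addl.
have /choice[T hT] : forall i, exists T : {ffun 'I_n.+1 -> X} -> R, [/\ is_test T,
      forall j, accept_prob (Q0 j) (Q j) T <= C * expR (- (n%:R * r)) &
      expR (- (n%:R * (c + e / 2))) <= accept_prob (P0 i) (P i) T].
  by move=> i; exact: hm.
pose S x := #|I|%:R^-1 * \sum_i T i x.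
have SE (p : X -> R) (A : X -> X -> R) :
    accept_prob p A S = #|I|%:R^-1 * \sum_i accept_prob p A (T i).
  rewrite /accept_prob /S mulr_sumr.
  under [RHS]eq_bigr do rewrite mulr_sumr.
  rewrite exchange_big/=; apply: eq_bigr => x _.
  rewrite -mulrA mulr_suml mulr_sumr; apply: eq_bigr => i _; by [].
have avg (f : I -> R) (b : R) : (forall i, f i <= b) -> #|I|%:R^-1 * \sum_i f i
  <= b.
  move=> fb; rewrite mulrC ler_pdivrMr//.
  apply: (@le_trans _ _ (\sum_(i : I) b)); first by apply: ler_sum => i _;
    exact: fb.
  by rewrite sumr_const mulr_natr.
exists S; split.
- move=> x; apply/andP; split.
    rewrite mulr_ge0 ?invr_ge0// sumr_ge0// => i _.
    by have [/(_ x)/andP[]] := hT i.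
  by apply: avg => i; have [/(_ x)/andP[]] := hT i.
- apply: bigmax_le; first by rewrite mulr_ge0 ?expR_ge0.
  by move=> j _; rewrite SE; apply: avg => i; have [_ + _] := hT i; apply.
- apply: type1_error_compl_ge => [|i].
    by rewrite -[leRHS]expR0 ler_expR oppr_le0 mulr_ge0// addr_ge0// ltW.
  rewrite SE; apply: (@le_trans _ _ (#|I|%:R^-1 * expR (- (n%:R * (c + e / 2))))).
    have := hn2 n nn2.
    rewrite -(ler_pM2r (expR_gt0 (- (n%:R * (c + e / 2))))) => /(le_trans _); apply.
    by rewrite -expRD ler_expR; lra.
  rewrite ler_pM2l ?invr_gt0//.
  have [_ _ /le_trans] := hT i; apply.
  rewrite (bigD1 i)//= lerDl; apply: sumr_ge0 => i' _.
  have [tT _ _] := hT i'.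
  apply: sumr_ge0 => x _; rewrite mulr_ge0//; first by have /andP[] := tT x.
  by rewrite ltW// markov_prob_gt0.
Qed.

(** The tests built so far depend on the slack [e]. Taking for each [n] a test within a factor 2 of
    the supremum beats all of them at once, so the slack becomes sublinear. *)
Lemma logrho_bound_sc_achievable (R : realType) (X I J : finType) (x0 : X) (i0 : I)
    (P0 : I -> X -> R) (P : I -> X -> X -> R)
    (Q0 : J -> X -> R) (Q : J -> X -> X -> R) (r c : R) :
  (forall i a, 0 < P0 i a) -> (forall i, \sum_a P0 i a = 1) ->
  (forall i x y, 0 < P i x y) -> (forall i y, \sum_x P i x y = 1) ->
  (forall j a, 0 < Q0 j a) -> (forall j, \sum_a Q0 j a = 1) ->
  (forall j x y, 0 < Q j x y) -> (forall j y, \sum_x Q j x y = 1) ->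
  0 <= r -> 0 <= c ->
  (forall i (nu : J -> R), (forall j, 0 <= nu j) ->
     (\sum_j nu j) * (r * ln 2) - logrho (P i) Q nu <=
     (c * ln 2) * (1 + \sum_j nu j)) ->
  sc_achievable P0 P Q0 Q r c.
Proof.
move=> p0 p1 W0 W1 q0 q1 V0 V1 r0 c0 Hc.
have ln20 := ln2_gt0 R.
have [B B0 hB] := fin_bounded R (I * X)%type (fun u => (P0 u.1 u.2)^-1).
pose C := B + 1.
have C1 : 1 <= C by rewrite lerDr.
have C0 : 0 < C by exact: lt_le_trans C1.
have qC i j a : Q0 j a <= C * P0 i a.
  have q1' : Q0 j a <= 1.
    by rewrite -(q1 j) (bigD1 a)//= lerDl sumr_ge0// => b _; exact: ltW.
  apply: le_trans q1' _; rewrite -ler_pdivrMr// mul1r.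
  by apply: le_trans (ler_norm _) (le_trans (hB (i, a)) _); rewrite lerDl.
pose beta n := C * expR (- (n%:R * (r * ln 2))).
pose V n := [set u | exists T : {ffun 'I_n.+1 -> X} -> R,
   [/\ is_test T, type2_error Q0 Q T <= beta n & u = 1 - type1_error P0 P T]].
(* A constant test meets the type II constraint with positive acceptance, so the supremum is
   positive and the logarithm of [u n] below is meaningful. *)
have Vpos n : V n (1 - type1_error P0 P (fun _ : {ffun 'I_n.+1 -> X} => expR (-
  (n%:R * (r * ln 2))))) /\
   0 < 1 - type1_error P0 P (fun _ : {ffun 'I_n.+1 -> X} => expR (- (n%:R * (r
     * ln 2)))).
  set k := expR _.
  have k1 : k <= 1.
    by rewrite -[leRHS]expR0 ler_expR oppr_le0 mulr_ge0// mulr_ge0// ltW.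
  have acc (p : X -> R) (A : X -> X -> R) : \sum_a p a = 1 -> (forall y, \sum_x
    A x y = 1) ->
      accept_prob p A (fun _ : {ffun 'I_n.+1 -> X} => k) = k.
    by move=> p1' A1; rewrite /accept_prob -mulr_sumr markov_prob_sum// mulr1.
  split; last first.
    apply: lt_le_trans (expR_gt0 (- (n%:R * (r * ln 2)))) _; apply:
      type1_error_compl_ge => // i.
    by rewrite acc.
  exists (fun _ => k); split=> //.
    by move=> x; rewrite expR_ge0 k1.
  have kb : k <= beta n by rewrite /beta ler_peMl// expR_ge0.
  apply: bigmax_le; first by apply: le_trans kb; exact: expR_ge0.
  by move=> j _; rewrite acc.
have V1' n u : V n u -> u <= 1.
  move=> [T [tT _ ->]]; rewrite gerBl; exact: bigmax_ge_id.
have Vsup n : has_sup (V n).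
  split; first by exists (1 - type1_error P0 P (fun _ : {ffun 'I_n.+1 -> X} =>
    expR (- (n%:R * (r * ln 2))))); case: (Vpos n).
  by exists 1 => u; exact: V1'.
have supV n : 0 < sup (V n).
  have [Vu u0] := Vpos n; apply: lt_le_trans u0 _; exact: sup_upper_bound.
have Tex n : exists T : {ffun 'I_n.+1 -> X} -> R,
   [/\ is_test T, type2_error Q0 Q T <= beta n & sup (V n) / 2 < 1 -
     type1_error P0 P T].
  have [|u [T [tT bT ->]] hu] := @sup_adherent _ (V n) (sup (V n) / 2) _ (Vsup n).
    by rewrite divr_gt0.
  exists T; split=> //; apply: le_lt_trans hu.
  by rewrite lerBrDr -splitr.
pose T n := sval (cid (Tex n)).
have hT n := svalP (cid (Tex n)).
pose u n := 1 - type1_error P0 P (T n).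
have u0 n : 0 < u n by have [_ _] := hT n; apply: lt_trans; rewrite divr_gt0.
have u1 n : u n <= 1 by rewrite gerBl; exact: bigmax_ge_id.
exists T; split.
- by move=> n; have [] := hT n.
- exists (fun=> ln C / ln 2).
    apply/sublinearP => d d0; exists (Num.bound (`|ln C / ln 2| / d)) => n nn0.
    rewrite [leRHS]mulrC -ler_pdivrMr//; apply: le_trans (ltW (archi_boundP _)) _.
      by rewrite divr_ge0// ltW.
    by rewrite ler_nat.
  move=> n; rewrite pow2E mulrDl divfK ?gt_eqF// expRD lnK ?posrE//.
  have [_ bT _] := hT n; apply: le_trans bT _.
  by rewrite /beta mulrC ler_pM2r// ler_expR !mulNr mulrA.
(* The chosen tests may have a better exponent than [c]; truncation at 0 keeps the error term
   sublinear in that case. *)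
exists (fun n => Num.min 0 (ln (u n) / ln 2 + n%:R * c)); last first.
  move=> n; rewrite pow2E -/(u n) -[leRHS]lnK ?posrE// ler_expR.
  rewrite -ler_pdivlMr// -lerBrDl mulNr opprK ge_min lexx orbT//.
apply/sublinearP => d d0.
(* Half of [d] is the slack of the composite test, the other half pays for the factor 2 lost against
   the supremum. *)
have d2 : 0 < d / 2 * ln 2 by rewrite mulr_gt0// divr_gt0.
have [n1 hn1] := composite_test R X I J x0 i0 P0 P Q0 Q (r * ln 2) (c * ln 2)
  (d / 2 * ln 2) C
  p0 p1 W0 W1 q0 V0 (ltW C0) qC (mulr_ge0 c0 (ltW ln20)) d2 Hc.
have [n2 hn2] := expRN_eventually_le R (d / 2 * ln 2) 2 d2 (ltr0n _ 2).
exists (n1 + n2)%N => n nn0.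
have [T' [tT' bT' aT']] := hn1 n (leq_trans (leq_addr _ _) nn0).
have h2 := hn2 n (leq_trans (leq_addl _ _) nn0).
have su : sup (V n) / 2 < u n by have [_ _] := hT n.
have Vs : 1 - type1_error P0 P T' <= sup (V n).
  by apply: sup_upper_bound => //; exists T'.
have uE : expR (- (n%:R * (c + d) * ln 2)) <= u n.
  apply: (@le_trans _ _ (expR (- (n%:R * (c * ln 2 + d / 2 * ln 2))) * expR (-
    (n%:R * (d / 2 * ln 2))))).
    by rewrite -expRD ler_expR; lra.
  apply: (@le_trans _ _ (sup (V n) * 2^-1)); last exact: ltW.
  by rewrite ler_pM ?expR_ge0//; exact: le_trans aT' Vs.
have {}uE : - (n%:R * (c + d)) <= ln (u n) / ln 2.
  by rewrite ler_pdivlMr// mulNr -ler_expR lnK ?posrE.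
have nd : 0 <= n%:R * d by rewrite mulr_ge0// ltW.
rewrite ler_norml le_min ge_min; apply/andP; split; last first.
  by rewrite mulr_ge0// ltW.
by apply/andP; split; lra.
Qed.

(** * Finiteness of the supremum and identification of the optimal exponent *)

Lemma logrho_norm_le (R : realType) (X J : finType) (x0 : X)
    (P : X -> X -> R) (Q : J -> X -> X -> R) :
  (forall x y, 0 < P x y) -> (forall y, \sum_x P x y = 1) ->
  exists2 L, 0 <= L & forall nu, (forall j, 0 <= nu j) ->
    `|logrho P Q nu| <= L * \sum_j nu j.
Proof.
move=> P0 P1; have [L L0 hL] := logrho_lipschitz R X J x0 P Q P0.
exists L => // nu nu0.
have S0 : 0 <= \sum_j nu j by exact: sumr_ge0.
have nuS j : `|nu j| <= \sum_j nu j.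
  by rewrite ger0_norm// (bigD1 j)//= lerDl sumr_ge0.
have E0 := logrho0 R X J x0 P Q P0 P1.
have h1 : logrho P Q nu <= logrho P Q (fun=> 0) + L * \sum_j nu j.
  by apply: hL => // j; rewrite subr0.
have h2 : logrho P Q (fun=> 0) <= logrho P Q nu + L * \sum_j nu j.
  by apply: hL => // j; rewrite sub0r normrN.
by rewrite ler_norml; apply/andP; split; lra.
Qed.

Theorem theorem5p33 (R : realType) (X I J : finType)
  (I_nonempty : (0 < #|I|)%N) (J_nonempty : (0 < #|J|)%N)
  (P0 : I -> X -> R) (P : I -> X -> X -> R)
  (Q0 : J -> X -> R) (Q : J -> X -> X -> R)
  (P0_distr : forall i, is_distr (P0 i))
  (P0_full : forall i x, 0 < P0 i x)
  (Q0_distr : forall j, is_distr (Q0 j))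
  (Q0_full : forall j x, 0 < Q0 j x)
  (P_distr : forall i x1, is_distr (fun x2 => P i x2 x1))
  (P_pos : forall i x2 x1, 0 < P i x2 x1)
  (Q_distr : forall j x1, is_distr (fun x2 => Q j x2 x1))
  (Q_pos : forall j x2 x1, 0 < Q j x2 x1)
  (r : R) (r_ge0 : 0 <= r) :
  exists M : R -> R,
    (forall a : R, 1 < a ->
       is_max [set v | exists (i : I) (g : J -> R),
                 is_distr g /\ v = exponent_bound (P i) Q r a g]
              (M a)) /\
    exists Rstar : R,
      is_opt_sc_exponent P0 P Q0 Q r Rstar /\
      isLub [set M a | a in [set a : R | 1 < a]] Rstar.
Proof.
have [i0 _] := card_gt0P I_nonempty; have [j0 _] := card_gt0P J_nonempty.
have [x0 _] : exists x0 : X, true.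
  apply: contrapT => nX; have [_] := P0_distr i0.
  rewrite big1 => [/eqP|x _]; first by rewrite eq_sym oner_eq0.
  by exfalso; apply: nX; exists x.
have P1 i y : \sum_x P i x y = 1 by have [] := P_distr i y.
pose S a := [set v | exists (i : I) (g : J -> R),
                 is_distr g /\ v = exponent_bound (P i) Q r a g].
have /choice[M hM] : forall a, exists m, 1 < a -> is_max (S a) m.
  move=> a; have [a1|] := ltP 1 a; last by exists 0.
  have /choice[g hg] : forall i, exists g : J -> R, is_distr g /\
      forall g', is_distr g' -> exponent_bound (P i) Q r a g' <= exponent_bound
        (P i) Q r a g.
    move=> i; have [g gd gmax] := exponent_bound_max R X J x0 j0 (P i) Q r a
      (P_pos i) Q_pos a1.
    by exists g; split; [exact: gd|exact: gmax].
  have [i hi] := fin_argmin R I (fun i => - exponent_bound (P i) Q r a (g i)) i0.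
  exists (exponent_bound (P i) Q r a (g i)) => _; split.
    by exists i, (g i); split; [have [] := hg i|reflexivity].
  move=> _ [i' [g' [g'd ->]]].
  have [_ /(_ g' g'd) h1] := hg i'; have := hi i'; rewrite lerN2.
  exact: le_trans h1.
exists M; split; first exact: hM.
pose E := [set M a | a in [set a : R | 1 < a]].
have ln20 := ln2_gt0 R.
have /choice[L hL] : forall i, exists L, 0 <= L /\ forall nu : J -> R, (forall
  j, 0 <= nu j) ->
    `|logrho (P i) Q nu| <= L * \sum_j nu j.
  by move=> i; have [L] := logrho_norm_le R X J x0 (P i) Q (P_pos i) (P1 i);
    exists L.
have ebE i a g : 1 < a -> is_distr g -> exists2 l : R, `|l| <= L i * (a - 1) &
    exponent_bound (P i) Q r a g = ((a - 1) * (r * ln 2) - l) / (a * ln 2).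
  move=> a1 gd; exists (logrho (P i) Q (fun j => (a - 1) * g j)).
    have [g0 g1] := gd; have [_ h] := hL i.
    apply: le_trans (h _ _) _ => [j|]; first by rewrite mulr_ge0// subr_ge0 ltW.
    by rewrite -mulr_sumr g1 mulr1.
  exact: exponent_boundE (P_pos i) Q_pos a1 gd.
have E0 : E !=set0 by exists (M 2), 2 => //=; rewrite ltr1n.
have Esup : has_sup E.
  (* Since [logrho] is at most linear in [a - 1] in absolute value, the numerator is bounded by a
     multiple of [a - 1], and [(a - 1) / a <= 1] makes the bound uniform in [a]. *)
  split=> //; exists ((r * ln 2 + \sum_i L i) / ln 2) => _ [a /= a1 <-].
  have [[i [g [gd ->]]] _] := hM a a1.
  have [l la ->] := ebE i a g a1 gd.
  have a0 : 0 < a by exact: lt_trans a1.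
  rewrite invfM mulrA ler_pM2r ?invr_gt0// ler_pdivrMr//.
  have Li : L i <= \sum_i L i.
    by rewrite (bigD1 i)//= lerDl sumr_ge0// => i' _; have [] := hL i'.
  have Li0 : 0 <= L i by have [] := hL i.
  have rl : 0 <= r * ln 2 by rewrite mulr_ge0// ltW.
  apply: (@le_trans _ _ ((r * ln 2 + L i) * (a - 1))).
    by move: la; rewrite ler_norml; lra.
  apply: ler_pM; [exact: addr_ge0|by rewrite subr_ge0 ltW|by rewrite lerD2l|].
  by rewrite gerBl.
have Eub a : 1 < a -> M a <= sup E.
  by move=> a1; apply: sup_upper_bound => //; exists a.
have ebM i a g : 1 < a -> is_distr g -> exponent_bound (P i) Q r a g <= sup E.
  move=> a1 gd; apply: le_trans (Eub a a1).
  by have [_] := hM a a1; apply; exists i, g.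
(* As [a] decreases to 1 the exponent bound tends to 0; [a = 1 + d] with the [d] below already
   brings it above [- e]. *)
have sup0 : 0 <= sup E.
  apply/ler_addgt0Pr => e e0.
  pose g j : R := (j == j0)%:R.
  have gd : is_distr g.
    split=> [j|]; first by rewrite ler0n.
    by rewrite (bigD1 j0)//= /g eqxx big1 ?addr0// => j /negbTE ->.
  have Li0 : 0 <= L i0 by have [] := hL i0.
  have K0 : 0 < L i0 / ln 2 + 1 by rewrite ltr_wpDl// divr_ge0// ltW.
  pose d := e / (L i0 / ln 2 + 1).
  have d0 : 0 < d by rewrite divr_gt0.
  have a1 : 1 < 1 + d by rewrite ltrDl.
  have [l ld lE] := ebE i0 (1 + d) g a1 gd.
  have := ebM i0 (1 + d) g a1 gd; rewrite lE addrAC subrr add0r.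
  rewrite addrAC subrr add0r in ld.
  suff : - e <= (d * (r * ln 2) - l) / ((1 + d) * ln 2) by lra.
  have De : d * (L i0) <= e * ln 2.
    have -> : e * ln 2 = d * (L i0 + ln 2).
      by rewrite /d; field; rewrite !gt_eqF// ltr_wpDl.
    by rewrite ler_pM2l// lerDl ltW.
  have d1 : 0 < 1 + d by exact: lt_trans a1.
  rewrite ler_pdivlMr; last exact: mulr_gt0.
  have rl : 0 <= d * (r * ln 2).
    by apply: mulr_ge0; [exact: ltW|apply: mulr_ge0 => //; exact: ltW].
  have edl : 0 <= e * d * ln 2 by apply: ltW; rewrite mulr_gt0// mulr_gt0.
  by move: ld; rewrite ler_norml; lra.
exists (sup E); split; last first.
  by split=> [_ [a a1 <-]|b Eb]; [exact: Eub|exact: ge_sup].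
split.
  apply: (logrho_bound_sc_achievable R X I J x0 i0) => //.
  - by move=> i; have [] := P0_distr i.
  - by move=> j; have [] := Q0_distr j.
  - by move=> j y; have [] := Q_distr j y.
  move=> i nu nu0.
  have s0 : 0 <= \sum_j nu j by exact: sumr_ge0.
  (* For [nu = 0] the inequality reduces to nonnegativity of the supremum. Otherwise [nu] is [a - 1]
     times a distribution, with [a = 1 + s], and the inequality is the bound by the supremum
     multiplied by [a * ln 2]. *)
  have [/eqP sz|snz] := eqVneq (\sum_j nu j) 0.
    have [_ /(_ nu nu0)] := hL i.
    rewrite (eqP sz) mulr0 normr_le0 => /eqP ->.
    by rewrite mul0r subr0 addr0 mulr1 mulr_ge0// ltW.
  have sp : 0 < \sum_j nu j by rewrite lt_neqAle eq_sym snz.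
  pose s := \sum_j nu j; pose g j := nu j / s.
  have gd : is_distr g.
    by split=> [j|]; rewrite /g ?divr_ge0// -mulr_suml divff.
  have a1 : 1 < 1 + s by rewrite ltrDl.
  have := ebM i (1 + s) g a1 gd.
  rewrite (exponent_boundE _ _ _ _ _ _ _ _ (P_pos i) Q_pos a1 gd).
  rewrite addrAC subrr add0r.
  have -> : (fun j => s * g j) = nu.
    by apply/funext => j; rewrite /g mulrCA divff ?mulr1.
  rewrite ler_pdivrMr; last by rewrite mulr_gt0// (lt_trans _ a1).
  by move=> /le_trans; apply; rewrite mulrA mulrAC.
move=> s /= hs; apply: ge_sup => // _ [a a1 <-].
have [[i [g [gd ->]]] _] := hM a a1.
exact: (sc_achievable_ge_exponent_bound R X I J x0 P0 P Q0 Q P0_full Q0_full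
  P_pos Q_pos r s a i g hs a1 gd).
Qed.
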